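(* There are universal constants $C>0$ and $c>0$ such that the following holds. Let $d\ge n\ge 1$ be integers, $v>0$, and $\boldsymbol\lambda\in\mathbb{R}_{++}^d$. If the training data $(\boldsymbol x_1,y_1),\dots,(\boldsymbol x_n,y_n)\in\mathbb{R}^d\times\{-1,+1\}$ follow the independent features model with sub-Gaussian parameter $v$ and model parameter $\boldsymbol\lambda$ (with the general label model), then the probability that every training example is a support vector is at least $$1-\exp\left(-c\cdot\min\left\{\frac{d_2}{v^2},\,\frac{d_\infty}{v}\right\}+Cn\right)-\exp\left(-c\cdot\frac{d_\infty}{vn}+C\log n\right).$$
   Context: $\mathbb{R}_{++}=\{x\in\mathbb{R}:x>0\}$. Universal constants do not depend on $d$, $n$, or properties of the data distribution. Effective dimensions: for $\boldsymbol\lambda\in\mathbb{R}_{++}^d$, $d_2:=\|\boldsymbol\lambda\|_1^2/\|\boldsymbol\lambda\|_2^2$ and $d_\infty:=\|\boldsymbol\lambda\|_1/\|\boldsymbol\lambda\|_\infty$. Feature model (independent features): $\boldsymbol x_i=\mathrm{diag}(\boldsymbol\lambda)^{1/2}\boldsymbol z_i$ for $i=1,\dots,n$, where the $n\times d$ random matrix $\boldsymbol Z=[\boldsymbol z_1|\cdots|\boldsymbol z_n]^{\mathsf T}=(z_{i,j})$ has independent entries such that each $z_{i,j}$ satisfies $\mathbb{E}(z_{i,j})=0$, $\mathbb{E}(z_{i,j}^2)=1$, and $\mathbb{E}(e^{tz_{i,j}})\le e^{vt^2/2}$ for all $t\in\mathbb{R}$ (sub-Gaussian with parameter $v$). Label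 model: conditional on $\boldsymbol x_1,\dots,\boldsymbol x_n$, the $y_1,\dots,y_n$ are independent $\{-1,+1\}$-valued random variables such that the conditional distribution of $y_i$ depends only on $\boldsymbol x_i$, i.e., for each $i$, $y_i$ is conditionally independent of $(\boldsymbol x_j,y_j)_{j\ne i}$ given $\boldsymbol x_i$. (Fixed non-random labels are a special case.) Support vectors: the (hard-margin, homogeneous) SVM problem is $\min_{\boldsymbol w\in\mathbb{R}^d}\frac12\|\boldsymbol w\|_2^2$ subject to $y_i\boldsymbol x_i^{\mathsf T}\boldsymbol w\ge1$ for all $i$. With $\boldsymbol K$ the $n\times n$ Gram matrix $K_{i,j}=\boldsymbol x_i^{\mathsf T}\boldsymbol x_j$ and $\boldsymbol y=(y_1,\dots,y_n)$, its Lagrangian dual is $\max_{\boldsymbol\alpha\in\mathbb{R}^n}\sum_{i=1}^n\alpha_i-\frac12\boldsymbol\alpha^{\mathsf T}\mathrm{diag}(\boldsymbol y)^{\mathsf T}\boldsymbol K\,\mathrm{diag}(\boldsymbol y)\boldsymbol\alpha$ subject to $\alpha_i\ge0$ for all $i$. The support vectors are the examples $(\boldsymbol x_i,y_i)$ with $\alpha_i^\star>0$, where $\boldsymbol\alpha^\star$ is an optimal dual solution (unique when $\boldsymbol K$ is non-singular). Convention in general: ''every training example is a support vector'' means that the dual has an optimal solution and every optimal solution has all coordinates positive. *)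

(* Defs.v *)
From mathcomp Require Export all_boot all_order all_algebra.
From mathcomp Require Export all_classical all_reals all_analysis.
Export Order.TTheory GRing.Theory Num.Theory.
Export numFieldNormedType.Exports.

#[export] Set Implicit Arguments.
#[export] Unset Strict Implicit.
#[export] Unset Printing Implicit Defensive.

Local Open Scope classical_set_scope.
Local Open Scope ring_scope.

Definition l1_norm (R : realType) (d : nat) (lam : 'rV[R]_d) : R :=
  \sum_(j < d) `|lam 0 j|.

Definition l2_norm (R : realType) (d : nat) (lam : 'rV[R]_d) : R :=
  Num.sqrt (\sum_(j < d) lam 0 j ^+ 2).

Definition linf_norm (R : realType) (d : nat) (lam : 'rV[R]_d) : R :=
  \big[Num.max/0]_(j < d) `|lam 0 j|.

Definition d_2 (R : realType) (d : nat) (lam : 'rV[R]_d) : R :=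
  l1_norm lam ^+ 2 / l2_norm lam ^+ 2.

Definition d_inf (R : realType) (d : nat) (lam : 'rV[R]_d) : R :=
  l1_norm lam / linf_norm lam.

Definition gram (R : realType) (n d : nat) (x : 'I_n -> 'cV[R]_d) : 'M[R]_n :=
  \matrix_(i, j) ((x i)^T *m x j) 0 0.

Definition svm_dual_objective (R : realType) (n d : nat)
    (x : 'I_n -> 'cV[R]_d) (y : 'rV[R]_n) (a : 'cV[R]_n) : R :=
  \sum_(i < n) a i 0
  - 2^-1 * (a^T *m (diag_mx y)^T *m gram x *m diag_mx y *m a) 0 0.

Definition svm_dual_feasible (R : realType) (n : nat) (a : 'cV[R]_n) : Prop :=
  forall i, 0 <= a i 0.

Definition svm_dual_optimal (R : realType) (n d : nat)
    (x : 'I_n -> 'cV[R]_d) (y : 'rV[R]_n) (a : 'cV[R]_n) : Prop :=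
  svm_dual_feasible a /\
  forall b : 'cV[R]_n, svm_dual_feasible b ->
    svm_dual_objective x y b <= svm_dual_objective x y a.

(* When the Gram matrix is singular the dual may have no optimal solution or
   several ones; the property asks for existence and for positivity of the
   coordinates of all of them. *)
Definition all_support_vectors (R : realType) (n d : nat)
    (x : 'I_n -> 'cV[R]_d) (y : 'rV[R]_n) : Prop :=
  (exists a, svm_dual_optimal x y a) /\
  (forall a, svm_dual_optimal x y a -> forall i, 0 < a i 0).

Definition sigma_of (R : realType) (disp : measure_display)
    (T : measurableType disp) (F : set (T -> R)) : set (set T) :=
  <<s \bigcup_(f in F) preimage_set_system setT f measurable >>.

Definition mutually_independent (R : realType) (disp : measure_display)
    (T : measurableType disp) (P : probability T R) (I : finType)
    (X : I -> T -> R) : Prop :=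
  forall (J : {set I}) (A : I -> set R), (forall i, measurable (A i)) ->
    (P (\bigcap_(i in [set` J]) X i @^-1` A i)
     = \prod_(i in J) P (X i @^-1` A i))%E.

(* [q] is a version of the conditional probability P(A | G). *)
Definition cond_prob_version (R : realType) (disp : measure_display)
    (T : measurableType disp) (P : probability T R) (G : set (set T))
    (A : set T) (q : T -> R) : Prop :=
  [/\ forall B : set R, measurable B -> G (q @^-1` B),
      P.-integrable [set: T] (EFin \o q) &
      forall B, G B -> (\int[P]_(w in B) (q w)%:E = P (A `&` B))%E].

(* The classes of events [E i] are conditionally independent given the
   sigma-algebra [G], i.e. P(\bigcap_(i in J) A i | G) is a.s. the product of
   the P(A i | G).  Versions exist by Radon-Nikodym and are a.s. unique, so it
   is immaterial which versions [q i] are used. *)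
Definition cond_independent (R : realType) (disp : measure_display)
    (T : measurableType disp) (P : probability T R) (G : set (set T))
    (I : finType) (E : I -> set (set T)) : Prop :=
  forall A : I -> set T, (forall i, E i (A i)) ->
    exists q : I -> T -> R,
      (forall i, cond_prob_version P G (A i) (q i)) /\
      (forall J : {set I},
         cond_prob_version P G (\bigcap_(i in [set` J]) A i)
           (fun w => \prod_(i in J) q i w)).

Definition subgaussian (R : realType) (disp : measure_display)
    (T : measurableType disp) (P : probability T R) (v : R) (X : T -> R)
    : Prop :=
  forall t : R,
    ('E_P[fun w => expR (t * X w)] <= (expR (v * t ^+ 2 / 2))%:E)%E.

Definition independent_entries (R : realType) (disp : measure_display)
    (T : measurableType disp) (P : probability T R) (n d : nat) (v : R)
    (Z : 'I_n -> 'I_d -> {RV P >-> R}) : Prop :=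
  mutually_independent P (fun k : 'I_n * 'I_d => Z k.1 k.2 : T -> R) /\
  forall i j,
    [/\ ('E_P[Z i j] = 0)%E,
        ('E_P[fun w => (Z i j w ^+ 2)%R] = 1)%E &
        subgaussian P v (Z i j)].

(* x_i = diag(lam)^(1/2) z_i, as a function of the outcome [w] *)
Definition feature (R : realType) (disp : measure_display)
    (T : measurableType disp) (P : probability T R) (n d : nat)
    (lam : 'rV[R]_d) (Z : 'I_n -> 'I_d -> {RV P >-> R})
    (w : T) (i : 'I_n) : 'cV[R]_d :=
  diag_mx (map_mx Num.sqrt lam) *m \col_j Z i j w.

Definition sigma_features (R : realType) (disp : measure_display)
    (T : measurableType disp) (n d : nat) (x : T -> 'I_n -> 'cV[R]_d)
    : set (set T) :=
  sigma_of [set f : T -> R | exists i j, f = fun w => x w i j 0].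

Definition sigma_feature (R : realType) (disp : measure_display)
    (T : measurableType disp) (n d : nat) (x : T -> 'I_n -> 'cV[R]_d)
    (i : 'I_n) : set (set T) :=
  sigma_of [set f : T -> R | exists j, f = fun w => x w i j 0].

Definition sigma_label (R : realType) (disp : measure_display)
    (T : measurableType disp) (n : nat) (y : 'I_n -> T -> R) (i : 'I_n)
    : set (set T) :=
  sigma_of [set y i].

(* generated by the examples (x_k, y_k), k != i *)
Definition sigma_other_examples (R : realType) (disp : measure_display)
    (T : measurableType disp) (n d : nat) (x : T -> 'I_n -> 'cV[R]_d)
    (y : 'I_n -> T -> R) (i : 'I_n) : set (set T) :=
  sigma_of [set f : T -> R | exists k, k != i /\
    (f = y k \/ exists j, f = fun w => x w k j 0)].

Definition label_model (R : realType) (disp : measure_display)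
    (T : measurableType disp) (P : probability T R) (n d : nat)
    (x : T -> 'I_n -> 'cV[R]_d) (y : 'I_n -> {RV P >-> R}) : Prop :=
  [/\ forall i w, y i w = -1 \/ y i w = 1,
      cond_independent P (sigma_features x) (sigma_label (fun i => y i)) &
      forall i, cond_independent P (sigma_feature x i)
        (fun b : bool => if b then sigma_label (fun k => y k) i
                         else sigma_other_examples x (fun k => y k) i)].

(* Main.v *)
From HB Require Import structures.
Require Import Defs.
From mathcomp Require Import measurable_realfun ring lra zify.

(** Write K for the Gram matrix, Q = diag(y) K diag(y), L for the l1 norm of
the weights and Li for their maximum.

The event is an explicit one.  A dual optimum with positive coordinates is an
interior stationary point, so it solves Q a = 1; and when Q is singular such an
optimum can be moved along the kernel of Q, at constant objective, until some
coordinate vanishes.  Hence all examples are support vectors exactly when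
det Q is nonzero and Q^-1 1 is positive ([all_support_vectorsP]); this is a
condition on rational functions of the data, so the event is measurable.

Leave one out.  Let W_i be the combination of the features x_j, j <> i, with
<x_j, W_i> = y_j for all j <> i.  If K is positive definite, the i-th coordinate
of Q^-1 1 is positive as soon as |<x_i, W_i>| < 1
([all_support_vectors_of_loo]).  It remains to bound the probability that K is
not at least L / 2, and then that of |<x_i, W_i>| >= 1.

First exponential ([gram_concentration]).  For a unit vector u, u^T K u is a
sum of lam_j xi_j^2 with independent xi_j of mean square 1 that are
sub-Gaussian with the same parameter v.  Squares of such variables have
exponential moments, whence a two-sided Bernstein bound
([weighted_sqr_tail]).  It is used at the exponentially many points of an integer
lattice in a ball; rounding an arbitrary vector to the lattice bounds the norm
M of the deviation K - L by a contraction in M itself ([quad_dev_le]).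

Second exponential ([loo_event_bound]).  When K >= L / 2, the squared norm of
W_i is at most 2 n / L ([sqnorm_loo_interpolator]).  If W_i were independent of
x_i, then <x_i, W_i> would be sub-Gaussian with parameter v Li (2 n / L), and
|<x_i, W_i>| >= 1 would have probability at most 2 exp (- d_inf / (4 v n)).
The labels in W_i are not functions of the other features, but the label model
gives them a conditional probability given all features that depends on the
other features only ([labels_density]); so the bound holds for each of the sign
patterns of the other labels, weighted by its probability, and these weights sum
to 1.  The union over i costs a factor n, and for n = 1 there is nothing to
bound since W_i = 0.

Independence enters through one tool, [freezing]: two independent
sub-sigma-algebras turn an integral over the diagonal into a double integral. *)

Local Open Scope classical_set_scope.
Local Open Scope ring_scope.

(** * Generated sigma-algebras and independent blocks *)

Local Notation gen_by F := (\bigcup_(f in F) preimage_set_system setT f measurable).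
(** The same points with the sigma-algebra generated by the functions in [F]: being
measurable for a sub-sigma-algebra becomes plain measurability from this type. *)
Local Notation salg F := (g_sigma_algebraType (gen_by F)).

Section SigmaOf.
Context (R : realType) (disp : measure_display) (T : measurableType disp).
Implicit Types F : set (T -> R).

Lemma sigma_of_gen F f : F f -> measurable_fun [set: salg F] (f : salg F -> R).
Proof.
move=> Ff _ A mA; apply: sub_sigma_algebra; exists f => //; exists A => //.
Qed.

Lemma sigma_of_subset F (G : set (set T)) :
  sigma_algebra setT G ->
  (forall f, F f -> forall B, measurable B -> G (f @^-1` B)) ->
  sigma_of F `<=` G.
Proof.
move=> sG FG; apply: smallest_sub => // _ [f Ff [C mC <-]].
by rewrite setTI; exact: FG.
Qed.

Lemma sigma_of_le F F' :
  (forall f, F f -> measurable_fun [set: salg F'] (f : salg F' -> R)) ->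
  sigma_of F `<=` sigma_of F'.
Proof.
move=> FF'; apply: sigma_of_subset; first exact: smallest_sigma_algebra.
by move=> f Ff B mB; rewrite -[X in sigma_of _ X]setTI; exact: (FF' f Ff).
Qed.

Lemma sigma_of_measurable F :
  (forall f, F f -> measurable_fun setT f) -> sigma_of F `<=` measurable.
Proof.
move=> Fm; apply: sigma_of_subset; first exact: sigma_algebra_measurable.
by move=> f Ff B mB; rewrite -[X in measurable X]setTI; exact: (Fm f Ff).
Qed.

Lemma measurable_fun_salgS F F' disp' (U : measurableType disp') (f : T -> U) :
  sigma_of F `<=` sigma_of F' ->
  measurable_fun [set: salg F] f -> measurable_fun [set: salg F'] f.
Proof. by move=> FF' mf mT A mA; apply: FF'; exact: mf. Qed.

Lemma measurable_fun_salg_ambient F disp' (U : measurableType disp') (f : T -> U) :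
  sigma_of F `<=` measurable ->
  measurable_fun [set: salg F] f -> measurable_fun [set: T] f.
Proof. by move=> FF' mf mT A mA; apply: FF'; exact: mf. Qed.

End SigmaOf.

Section Independence.
Context (R : realType) (disp : measure_display) (T : measurableType disp).
Variable P : probability T R.
Local Open Scope ereal_scope.

Definition indep_classes (G H : set (set T)) :=
  forall A B, G A -> H B -> P (A `&` B) = P A * P B.

(** For fixed [B] both sides are finite measures of [A], so a pi-system decides. *)
Lemma indep_classes_gen (G : set (set T)) (B : set T) :
  setI_closed G -> G setT -> G `<=` measurable -> measurable B ->
  (forall A, G A -> P (A `&` B) = P A * P B) ->
  forall A, <<s G >> A -> P (A `&` B) = P A * P B.
Proof.
move=> GI GT Gm mB GB.
have fPB : (0 <= fine (P B))%R by exact: fine_ge0.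
have Pm A : mscale (NngNum fPB) P A = P A * P B.
  by rewrite /mscale /= fineK 1?muleC// fin_num_measure.
move=> A sA; rewrite -Pm -[LHS]/(mrestr P mB A).
apply: (@g_sigma_algebra_measure_unique _ R T G Gm (fun=> setT)) sA => //.
- by rewrite bigcup_const//; exists 0%N.
- by move=> C GC; rewrite [RHS]Pm /= /mrestr GB.
- move=> _; rewrite /= /mrestr setTI (le_lt_trans (probability_le1 P mB))//.
  exact: ltry.
Qed.

Lemma indep_classes_sigma (G H : set (set T)) :
  setI_closed G -> setI_closed H -> G setT -> H setT ->
  G `<=` measurable -> H `<=` measurable ->
  indep_classes G H -> indep_classes <<s G >> <<s H >>.
Proof.
move=> GI HI GT HT Gm Hm GH A B sA sB.
have sm (K : set (set T)) : K `<=` measurable -> <<s K >> `<=` measurable.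
  by move=> Km; apply: smallest_sub => //; exact: sigma_algebra_measurable.
rewrite setIC muleC; apply: (indep_classes_gen HI HT Hm) sB => [|C HC].
  exact: sm sA.
rewrite setIC muleC; apply: (indep_classes_gen GI GT Gm) sA; first exact: Hm.
by move=> D GD; exact: GH.
Qed.

Section Family.
Variables (I : finType) (X : I -> T -> R).
Hypothesis mX : forall k, measurable_fun setT (X k).
Hypothesis Xind : mutually_independent P X.

Definition sigma_fam (J : {set I}) : set (set T) :=
  sigma_of [set f | exists2 k, k \in J & f = X k].

(** The pi-system behind [sigma_fam]: on it independence is the product rule for
finite subfamilies. *)
Definition cylinders (J : {set I}) : set (set T) :=
  [set C | exists2 A : I -> set R, forall k, measurable (A k) &
    C = \bigcap_(k in [set` J]) X k @^-1` A k].

Lemma cylindersI J : setI_closed (cylinders J).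
Proof.
move=> _ _ [A mA ->] [B mB ->]; exists (fun k => A k `&` B k).
  by move=> k; exact: measurableI.
by rewrite -bigcapI; apply: eq_bigcapr => k _; rewrite preimage_setI.
Qed.

Lemma cylindersT J : cylinders J setT.
Proof.
exists (fun=> setT) => //; rewrite (_ : \bigcap_(_ in _) _ = setT)//.
by apply/seteqP; split.
Qed.

Lemma cylinders_measurable J : cylinders J `<=` measurable.
Proof.
move=> _ [A mA ->]; apply: fin_bigcap_measurable => // k _.
by rewrite -[X in measurable X]setTI; exact: mX.
Qed.

Lemma sigma_fam_cylinders J : sigma_fam J `<=` <<s cylinders J >>.
Proof.
apply: sigma_of_subset; first exact: smallest_sigma_algebra.
move=> f [k kJ ->] B mB; apply: sub_sigma_algebra.
exists (fun l => if l == k then B else setT); first by move=> l; case: ifP.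
apply/seteqP; split=> [w Bw l _ /=|w /(_ k kJ)/=]; last by rewrite eqxx.
by case: eqVneq => [->|].
Qed.

(** For disjoint blocks, two cylinders intersect in a cylinder over the union of
the blocks, and the product rule splits accordingly. *)
Lemma sigma_fam_indep (J K : {set I}) : [disjoint J & K]%bool ->
  indep_classes (sigma_fam J) (sigma_fam K).
Proof.
move=> JK A B /sigma_fam_cylinders sA /sigma_fam_cylinders sB.
apply: indep_classes_sigma sA sB; try exact: cylindersI;
  try exact: cylindersT; try exact: cylinders_measurable.
move=> {A B}_ _ [A mA ->] [B mB ->].
pose C k := if k \in J then A k else B k.
have mC k : measurable (C k) by rewrite /C; case: ifP.
have -> : \bigcap_(k in [set` J]) X k @^-1` A k `&`
          \bigcap_(k in [set` K]) X k @^-1` B k =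
          \bigcap_(k in [set` (J :|: K)%SET]) X k @^-1` C k.
  apply/seteqP; split=> [w [wA wB] k /=|w wC].
    rewrite inE /C => kJK; case: ifPn => [kJ|kJ]; first exact: wA.
    by apply: wB; rewrite /= -(orFb (k \in K)) -(negbTE kJ).
  split=> k /= kJ.
    by have := wC k; rewrite /= inE kJ /C kJ; exact.
  by have := wC k; rewrite /= inE kJ orbT /C (disjointFl JK kJ); exact.
rewrite !Xind//.
rewrite (eq_bigl [predU J & K]); last by move=> k; rewrite !inE.
rewrite bigU//=; congr (_ * _); apply: eq_bigr => k kJ.
  by rewrite /C kJ.
by rewrite /C (disjointFl JK kJ).
Qed.

End Family.
End Independence.

(** * Freezing one of two independent sigma-algebras *)

Section Freezing.
Context (R : realType) (disp : measure_display) (T : measurableType disp).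
Variable P : probability T R.
Local Open Scope ereal_scope.

(** Independence identifies the joint law with the product law on rectangles, hence
everywhere; the rest is Tonelli. *)
Lemma freezing_RV d1 d2 (U1 : measurableType d1) (U2 : measurableType d2)
    (X : {mfun T >-> U1}) (Y : {mfun T >-> U2}) (f : U1 * U2 -> \bar R) :
  (forall A B, measurable A -> measurable B ->
     P (X @^-1` A `&` Y @^-1` B) = P (X @^-1` A) * P (Y @^-1` B)) ->
  measurable_fun setT f -> (forall x, 0 <= f x) ->
  \int[P]_w f (X w, Y w) = \int[P]_w \int[P]_w' f (X w', Y w).
Proof.
move=> XY mf f0.
pose D w := (X w, Y w).
have mD : measurable_fun setT D by exact: measurable_fun_pair.
transitivity (\int[pushforward P D]_z f z).
  by rewrite ge0_integral_pushforward.
have -> : \int[pushforward P D]_z f z =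
          \int[distribution P X \x distribution P Y]_z f z.
  by apply: eq_measure_integral => A mA _; apply/esym;
     apply: (@product_measure_unique _ _ _ _ _ (distribution P X)
              (distribution P Y) (pushforward P D)) => // B C mB mC;
     rewrite /pushforward -XY.
rewrite fubini_tonelli2//= /fubini_G ge0_integral_distribution//.
- apply: eq_integral => w _ /=.
  rewrite ge0_integral_distribution//.
  by apply: measurableT_comp => //; exact: measurable_pair2.
- exact: (measurable_fun_fubini_tonelli_G (m1 := distribution P X)).
- by move=> y; exact: integral_ge0.
Qed.

(** [freezing_RV] for the identity map, read through two sub-sigma-algebras.  The
inner integral is the conditional expectation given [F2], computed with the
[F2]-measurable ingredients frozen. *)
Lemma freezing (F1 F2 : set (T -> R)) (f : salg F1 * salg F2 -> \bar R) :
  sigma_of F1 `<=` measurable -> sigma_of F2 `<=` measurable ->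
  indep_classes P (sigma_of F1) (sigma_of F2) ->
  measurable_fun setT f -> (forall x, 0 <= f x) ->
  \int[P]_w f (w, w) = \int[P]_w \int[P]_w' f (w', w).
Proof.
move=> m1 m2 F12 mf f0.
have mid (F : set (T -> R)) : sigma_of F `<=` measurable ->
    measurable_fun [set: T] (fun w : T => w : salg F).
  by move=> mF _ A mA; rewrite setTI; exact: mF.
pose X : {mfun T >-> salg F1} := HB.pack (fun w : T => w : salg F1)
  (isMeasurableFun.Build _ _ _ _ _ (mid _ m1)).
pose Y : {mfun T >-> salg F2} := HB.pack (fun w : T => w : salg F2)
  (isMeasurableFun.Build _ _ _ _ _ (mid _ m2)).
exact: (@freezing_RV _ _ _ _ X Y).
Qed.

(** The form used for tail bounds: a bound on each frozen integral can be
integrated, whatever its dependence on the frozen point. *)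
Lemma freezing_le (F1 F2 : set (T -> R)) (f : salg F1 * salg F2 -> \bar R)
    (g : T -> \bar R) :
  sigma_of F1 `<=` measurable -> sigma_of F2 `<=` measurable ->
  indep_classes P (sigma_of F1) (sigma_of F2) ->
  measurable_fun setT f -> (forall x, 0 <= f x) ->
  measurable_fun setT g -> (forall w, \int[P]_w' f (w', w) <= g w) ->
  \int[P]_w f (w, w) <= \int[P]_w g w.
Proof.
move=> m1 m2 F12 mf f0 mg fg; rewrite freezing//; apply: ge0_le_integral => //.
  by move=> w _; exact: integral_ge0.
have mid : measurable_fun [set: T] (fun w : T => w : salg F1).
  by move=> _ A mA; rewrite setTI; exact: m1.
pose X : {mfun T >-> salg F1} := HB.pack (fun w : T => w : salg F1)
  (isMeasurableFun.Build _ _ _ _ _ mid).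
apply: (measurable_fun_salg_ambient m2).
have -> : (fun w => \int[P]_w' f (w', w)) =
    (fun w => \int[distribution P X]_x f (x, w)).
  apply/funext => w; rewrite ge0_integral_distribution//.
  by apply: measurableT_comp => //; exact: measurable_pair2.
exact: (measurable_fun_fubini_tonelli_G (m1 := distribution P X) f mf f0).
Qed.

Lemma indep_expectationM (F1 F2 : set (T -> R)) (g h : T -> \bar R) :
  sigma_of F1 `<=` measurable -> sigma_of F2 `<=` measurable ->
  indep_classes P (sigma_of F1) (sigma_of F2) ->
  measurable_fun [set: salg F1] g -> measurable_fun [set: salg F2] h ->
  (forall x, 0 <= g x) -> (forall x, 0 <= h x) ->
  \int[P]_w (g w * h w) = (\int[P]_w g w) * (\int[P]_w h w).
Proof.
move=> m1 m2 F12 mg mh g0 h0.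
have mg' : measurable_fun [set: T] g by exact: measurable_fun_salg_ambient mg.
have mh' : measurable_fun [set: T] h by exact: measurable_fun_salg_ambient mh.
rewrite (@freezing F1 F2 (fun z => g z.1 * h z.2))//=.
- under eq_integral do rewrite ge0_integralZr//.
  by rewrite ge0_integralZl// integral_ge0.
- by apply: emeasurable_funM; exact: measurableT_comp.
- by move=> x; rewrite mule_ge0.
Qed.

End Freezing.

(** * Moments of functions of independent variables *)

Lemma prode_le_expR_sum (R : realType) (S : Type) (s : seq S)
    (E : S -> \bar R) (b : S -> R) :
  (forall k, 0 <= E k <= (expR (b k))%:E)%E ->
  (\prod_(k <- s) E k <= (expR (\sum_(k <- s) b k))%:E)%E.
Proof.
move=> E_; rewrite expR_sum -prodEFin.
elim: s => [|k s IH]; first by rewrite !big_nil.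
rewrite !big_cons; have /andP[? ?] := E_ k; apply: lee_pmul => //.
by apply: prode_ge0 => i _; have /andP[] := E_ i.
Qed.

Lemma integrable_sqr (R : realType) (disp : measure_display)
    (T : measurableType disp) (P : probability T R) (X : T -> R) :
  measurable_fun setT X -> ('E_P[fun w => (X w ^+ 2)%R] = 1)%E ->
  P.-integrable setT (fun w => (X w ^+ 2)%:E).
Proof.
move=> mX X2; apply/integrableP; split.
  by apply/measurable_EFinP; exact: measurable_funX.
under eq_integral do rewrite gee0_abs ?lee_fin ?sqr_ge0//.
by move: X2; rewrite unlock => ->; exact: ltry.
Qed.

Section FamilyExpectation.
Context (R : realType) (disp : measure_display) (T : measurableType disp).
Variable P : probability T R.
Variables (I : finType) (X : I -> T -> R).
Hypothesis mX : forall k, measurable_fun setT (X k).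
Hypothesis Xind : mutually_independent P X.

Notation salg_fam J := (salg [set f | exists2 k, k \in J & f = X k]).

Lemma sigma_fam_measurable (J : {set I}) : sigma_fam X J `<=` measurable.
Proof. by apply: sigma_of_measurable => f [k _ ->]. Qed.

Lemma sigma_famS (J K : {set I}) : {subset J <= K} ->
  sigma_fam X J `<=` sigma_fam X K.
Proof.
move=> JK; apply: sigma_of_le => f [k kJ ->]; apply: sigma_of_gen.
by exists k => //; exact: JK.
Qed.

Lemma measurable_sigma_fam (J : {set I}) k : k \in J ->
  measurable_fun [set: salg_fam J] (X k : salg_fam J -> R).
Proof. by move=> kJ; apply: sigma_of_gen; exists k. Qed.

(** The factor [g j] may use all variables of its group [p k == j]; the groups are
disjoint, so the factors can be split off one by one. *)
Lemma expectation_prod_groups (S : eqType) (p : I -> S) (g : S -> T -> R)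
    (s : seq S) :
  uniq s ->
  (forall j, measurable_fun [set: salg_fam [set k | p k == j]%SET] (g j)) ->
  (forall j w, 0 <= g j w) ->
  (\int[P]_w (\prod_(j <- s) g j w)%:E = \prod_(j <- s) \int[P]_w (g j w)%:E)%E.
Proof.
move=> us mg g0; elim: s us => [_|j s IH /= /andP[js us]].
  rewrite big_nil; under eq_integral do rewrite big_nil.
  by rewrite integral_cst//= probability_setT mule1.
rewrite big_cons -IH//; under eq_integral do rewrite big_cons EFinM.
pose J1 := [set k | p k == j]%SET; pose J2 := [set k | p k \in s]%SET.
apply: (indep_expectationM (F1 := [set f | exists2 k, k \in J1 & f = X k])
  (F2 := [set f | exists2 k, k \in J2 & f = X k])).
- exact: (@sigma_fam_measurable J1).
- exact: (@sigma_fam_measurable J2).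
- apply: sigma_fam_indep => //; rewrite disjoint_subset.
  by apply/fintype.subsetP => k; rewrite !inE => /eqP ->.
- by apply/measurable_EFinP; exact: mg.
- apply/measurable_EFinP; apply: (@measurable_prod _ (salg_fam J2)) => i si.
  apply: measurable_fun_salgS (mg i); apply: sigma_famS => k.
  by rewrite !inE => /eqP ->.
- by move=> w; rewrite lee_fin.
- by move=> w; rewrite lee_fin; exact: prodr_ge0.
Qed.

Lemma mgf_lin_comb (v : R) (t : I -> R) (s : seq I) :
  (forall k, subgaussian P v (X k)) -> uniq s ->
  (\int[P]_w (expR (\sum_(k <- s) t k * X k w))%:E
    <= (expR (v * (\sum_(k <- s) t k ^+ 2) / 2))%:E)%E.
Proof.
move=> sX us; under eq_integral do rewrite expR_sum.
rewrite (expectation_prod_groups (p := id) (g := fun k w => expR (t k * X k w)))//;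
  last first.
- move=> j; apply: measurableT_comp => //; apply: measurable_funM => //.
  by apply: measurable_sigma_fam; rewrite inE.
rewrite mulr_sumr mulr_suml; apply: prode_le_expR_sum => k.
rewrite integral_ge0/=; last by move=> w _; rewrite lee_fin expR_ge0.
by have := sX k (t k); rewrite unlock.
Qed.

Hypothesis X0 : forall k, ('E_P[X k] = 0)%E.
Hypothesis X2 : forall k, ('E_P[fun w => (X k w ^+ 2)%R] = 1)%E.

Lemma integrable_X k : P.-integrable setT (fun w => (X k w)%:E).
Proof.
have i1 : P.-integrable setT (fun w => (1 + X k w ^+ 2)%:E).
  under eq_fun do rewrite EFinD; apply: integrableD => //.
    exact: finite_measure_integrable_cst.
  exact: integrable_sqr (mX k) (X2 k).
apply: le_integrable i1 => //; first exact/measurable_EFinP.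
move=> w _; rewrite lee_fin [leRHS]ger0_norm ?addr_ge0 ?sqr_ge0//.
by rewrite ler_norml; apply/andP; split; nra.
Qed.

Lemma second_moment_affine k (u y : R) :
  (\int[P]_w ((u * X k w + y) ^+ 2)%:E = (u ^+ 2 + y ^+ 2)%:E)%E.
Proof.
under eq_integral => w _.
  rewrite (_ : (u * X k w + y) ^+ 2 =
    u ^+ 2 * X k w ^+ 2 + (2 * u * y * X k w + y ^+ 2)); last by ring.
  rewrite EFinD (EFinM (u ^+ 2)) EFinD (EFinM (2 * u * y)); over.
have iX := integrable_X k; have iX2 := integrable_sqr (mX k) (X2 k).
have ic : P.-integrable setT (fun _ : T => (y ^+ 2)%:E).
  exact: finite_measure_integrable_cst.
have iZ := integrableZl measurableT (2 * u * y) iX.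
rewrite integralD//; [|exact: integrableZl|exact: integrableD].
rewrite integralD// integralZl// integralZl// integral_cst//.
have := X0 k; have := X2 k; rewrite unlock => -> ->.
by rewrite /= probability_setT mule0 add0e !mule1 EFinD.
Qed.

(** Freezing the later terms of the sum reduces to [second_moment_affine]; this
avoids the integrability of the cross products. *)
Lemma second_moment_lin_comb (u : I -> R) (s : seq I) : uniq s ->
  (\int[P]_w ((\sum_(k <- s) u k * X k w) ^+ 2)%:E
    = (\sum_(k <- s) u k ^+ 2)%:E)%E.
Proof.
elim: s => [_|j s IH /= /andP[js us]].
  rewrite big_nil; under eq_integral do rewrite big_nil expr0n.
  by rewrite integral0.
under eq_integral do rewrite big_cons.
rewrite big_cons EFinD -IH//.
pose J1 := [set j]%SET; pose J2 := [set k | k \in s]%SET.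
pose F1 := [set f | exists2 k, k \in J1 & f = X k].
pose F2 := [set f | exists2 k, k \in J2 & f = X k].
pose Y w := \sum_(k <- s) u k * X k w.
have mX1 : measurable_fun [set: salg F1] (X j : salg F1 -> R).
  by apply: measurable_sigma_fam; rewrite inE.
have mY : measurable_fun [set: salg F2] (Y : salg F2 -> R).
  have -> : Y = fun w => \sum_(i < size s) u (nth j s i) * X (nth j s i) w.
    by apply/funext => w; rewrite /Y (big_nth j) big_mkord.
  apply: (@measurable_sum _ (salg F2)) => i.
  apply: measurable_funM => //; apply: measurable_sigma_fam.
  by rewrite inE mem_nth.
have mYT : measurable_fun setT Y.
  by apply: measurable_fun_salg_ambient mY; exact: (@sigma_fam_measurable J2).
(* The current variable is integrated with the remaining sum frozen. *)
rewrite (@freezing _ _ _ P F1 F2 (fun z => ((u j * X j z.1 + Y z.2) ^+ 2)%:E)).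
- under eq_integral do rewrite /= second_moment_affine.
  under eq_integral do rewrite EFinD.
  rewrite ge0_integralD//.
  + by rewrite integral_cst//= probability_setT mule1.
  + by move=> w _; rewrite lee_fin sqr_ge0.
  + by move=> w _; rewrite lee_fin sqr_ge0.
  + by apply/measurable_EFinP; exact: measurable_funX.
- exact: (@sigma_fam_measurable J1).
- exact: (@sigma_fam_measurable J2).
- apply: sigma_fam_indep => //; rewrite disjoint_subset.
  by apply/fintype.subsetP => k; rewrite !inE => /eqP ->.
- apply/measurable_EFinP; apply: measurable_funX; apply: measurable_funD.
    by apply: measurable_funM => //; exact: measurableT_comp.
  exact: measurableT_comp.
- by move=> z; rewrite lee_fin sqr_ge0.
Qed.

End FamilyExpectation.

(** * Exponential moments of sub-Gaussian squares *)

Section Ladder.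
Context (R : realType).

Definition ladder_coef (k : nat) : R := expR ((k%:R + 1) ^+ 2 / 8 - k%:R ^+ 2).

(** A sub-Gaussian hypothesis speaks of [exp (t X)] only.  To reach [exp (X ^ 2)],
the Gaussian of [y] is dominated by exponentials with integer slopes: the slope
[k], the integer part of [|y|], is within 1 of the best one. *)
Lemma expR_sqr_le_ladder (y : R) : exists k : nat,
  expR (y ^+ 2 / 8) <= ladder_coef k * (expR (k%:R * y) + expR (- k%:R * y)).
Proof.
exists (Num.truncn `|y|); set k := Num.truncn _.
have /andP[ky yk] : k%:R <= `|y| < k.+1%:R by exact: truncn_itv.
have k0 : 0 <= k%:R :> R by [].
have yk1 : `|y| < k%:R + 1 by rewrite -natr1 in yk.
have ky2 : k%:R ^+ 2 <= k%:R * `|y| by rewrite expr2 ler_wpM2l.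
apply: (@le_trans _ _ (ladder_coef k * expR (k%:R * `|y|))).
  rewrite /ladder_coef -expRD ler_expR -(real_normK (num_real y)).
  have y0 := normr_ge0 y.
  have : `|y| ^+ 2 <= (k%:R + 1) ^+ 2 by nra.
  lra.
rewrite ler_wpM2l ?expR_ge0//.
have [y0|y0] := leP 0 y; first by rewrite ger0_norm// lerDl expR_ge0.
by rewrite ltr0_norm// mulrN -mulNr lerDr expR_ge0.
Qed.

(** This is the expectation of the term of slope [k] at parameter 1: since
[(k + 1)^2 / 8 - k^2 / 2 <= 2 - k], the sum over [k] converges geometrically. *)
Lemma ladder_term_le (k : nat) :
  ladder_coef k * (2 * expR (k%:R ^+ 2 / 2)) <= 2 * expR 2 * (2^-1) ^+ k.
Proof.
have -> : ladder_coef k * (2 * expR (k%:R ^+ 2 / 2)) =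
    2 * expR ((k%:R + 1) ^+ 2 / 8 - k%:R ^+ 2 / 2) :> R.
  rewrite /ladder_coef mulrCA -expRD; congr (_ * expR _); lra.
rewrite -mulrA ler_wpM2l//.
apply: (@le_trans _ _ (expR 2 * expR (- k%:R))).
  by rewrite -expRD ler_expR; have := sqr_ge0 (k%:R - 5 / 3 : R); nra.
rewrite ler_wpM2l ?expR_ge0// -[k%:R in leLHS]mulr1 expRN expRM_natl -exprVn.
rewrite lerXn2r ?nnegrE ?invr_ge0 ?expR_ge0//.
rewrite lef_pV2 ?posrE ?expR_gt0//; have := expR_ge1Dx (1 : R); lra.
Qed.


Lemma sum_pow_half_le n : \sum_(0 <= k < n) (2^-1) ^+ k <= 2 :> R.
Proof.
suff -> : \sum_(0 <= k < n) (2^-1) ^+ k = 2 - 2 * (2^-1) ^+ n :> R.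
  by rewrite gerBl mulr_ge0// exprn_ge0.
elim: n => [|n IH]; first by rewrite big_nil expr0; ring.
by rewrite big_nat_recr//= IH exprS; field.
Qed.

End Ladder.

Section SubgaussianSquare.
Context (R : realType) (disp : measure_display) (T : measurableType disp).
Variable P : probability T R.
Variables (v : R) (X : T -> R).
Hypothesis v0 : 0 < v.
Hypothesis mX : measurable_fun setT X.
Hypothesis sX : subgaussian P v X.

Definition subgauss_sqr_cst : R := 4 * expR 2.
Notation C0 := subgauss_sqr_cst.

(** Rescaled to parameter 1, the square is dominated by the sum of all terms of the
ladder, and the expectations of these are summable. *)
Lemma expectation_expR_sqr :
  (\int[P]_w (expR (X w ^+ 2 / (8 * v)))%:E <= C0%:E)%E.
Proof.
pose s := Num.sqrt v.
have s0 : 0 < s by rewrite sqrtr_gt0.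
have s2 : s ^+ 2 = v by rewrite sqr_sqrtr// ltW.
pose Y w := X w / s.
have mY : measurable_fun setT Y by apply: measurable_funM.
have mgfY t : (\int[P]_w (expR (t * Y w))%:E <= (expR (t ^+ 2 / 2))%:E)%E.
  have := sX (t / s); rewrite unlock (_ : v * _ / _ = t ^+ 2 / 2).
    by under eq_integral do rewrite mulrAC -mulrA.
  by rewrite -s2; field; rewrite gt_eqF.
pose h k w : R := ladder_coef R k * (expR (k%:R * Y w) + expR (- k%:R * Y w)).
have h0 k w : 0 <= h k w.
  by rewrite mulr_ge0 ?addr_ge0 ?expR_ge0.
have mexp t : measurable_fun setT (fun w => (expR (t * Y w))%:E).
  by apply/measurable_EFinP; apply: measurableT_comp => //; exact: measurable_funM.
have mh k : measurable_fun setT (fun w => (h k w)%:E).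
  apply/measurable_EFinP; apply: measurable_funM => //.
  by apply: measurable_funD; exact/measurable_EFinP/mexp.
have ih k : (\int[P]_w (h k w)%:E <= (2 * expR 2 * (2^-1) ^+ k)%:E)%E.
  under eq_integral do rewrite /h EFinM.
  have pg w : (0 <= (expR (k%:R * Y w) + expR (- k%:R * Y w))%:E)%E.
    by rewrite lee_fin addr_ge0 ?expR_ge0.
  have mg : measurable_fun setT
      (fun w => (expR (k%:R * Y w) + expR (- k%:R * Y w))%:E).
    by apply/measurable_EFinP; apply: measurable_funD; exact/measurable_EFinP/mexp.
  rewrite ge0_integralZl_EFin ?expR_ge0//.
  apply: (@le_trans _ _ ((ladder_coef R k * (2 * expR (k%:R ^+ 2 / 2)))%:E)%E);
    last by rewrite lee_fin ladder_term_le.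
  rewrite EFinM lee_pmul2l ?fin_numE//; last by rewrite lte_fin expR_gt0.
  under eq_integral do rewrite EFinD.
  rewrite ge0_integralD//.
  rewrite mulr_natl mulr2n EFinD leeD//.
  by rewrite -sqrrN; exact: mgfY.
apply: (@le_trans _ _ (\int[P]_w \sum_(k <oo) (h k w)%:E)%E).
  apply: ge0_le_integral => //.
  - apply/measurable_EFinP; apply: measurableT_comp => //.
    by apply: measurable_funM => //; exact: measurable_funX.
  - by apply: ge0_emeasurable_sum => // k w _ _; rewrite lee_fin.
  (* One term of the series already dominates. *)
  - move=> w _; have [k hk] := expR_sqr_le_ladder (Y w).
    apply: (@le_trans _ _ (h k w)%:E).
      rewrite lee_fin (le_trans _ hk)// ler_expR /Y expr_div_n s2.
      by rewrite invfM mulrA mulrAC.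
    apply: le_trans (@nneseries_lim_ge _ _ _ 0%N k.+1 _); last first.
      by move=> n _ _; rewrite lee_fin.
    rewrite big_nat_recr//= leeDr// sume_ge0// => i _.
    by rewrite lee_fin.
rewrite integral_nneseries//; last by move=> n w _; rewrite lee_fin.
apply: lime_le.
  by apply: is_cvg_nneseries => n _ _; apply: integral_ge0 => w _; rewrite lee_fin.
apply: nearW => n.
apply: (@le_trans _ _ (\sum_(0 <= k < n) (2 * expR 2 * (2^-1) ^+ k)%:E)%E).
  by apply: lee_sum => k _; exact: ih.
rewrite sumEFin lee_fin -mulr_sumr /subgauss_sqr_cst.
rewrite (_ : 4 * expR 2 = 2 * expR 2 * 2); last by ring.
by rewrite ler_wpM2l ?mulr_ge0 ?expR_ge0// sum_pow_half_le.
Qed.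


Lemma subgauss_sqr_cst_gt0 : 0 < C0.
Proof. by rewrite mulr_gt0 ?expR_gt0. Qed.

(** From [exp x - 1 <= x exp x] and [x <= exp x - 1], according to the sign of [x]. *)
Lemma expR_le_quadratic (x : R) : expR x <= 1 + x + x ^+ 2 * expR `|x|.
Proof.
have e1 : expR x - 1 <= x * expR x.
  have := expR_ge1Dx (- x); rewrite expRN => h.
  have := expR_gt0 x => ex.
  have : (1 - x) * expR x <= 1 by rewrite -ler_pdivlMr// mul1r.
  lra.
have e2 := expR_ge1Dx x.
have [x0|x0] := leP 0 x.
  rewrite ger0_norm//; nra.
have : x ^+ 2 * 1 <= x ^+ 2 * expR `|x|.
  by rewrite ler_wpM2l ?sqr_ge0// -expR0 ler_expR.
nra.
Qed.

Hypothesis X2 : ('E_P[fun w => (X w ^+ 2)%R] = 1)%E.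

Lemma integral_sqr1 : (\int[P]_w (X w ^+ 2)%:E = 1)%E.
Proof. by have := X2; rewrite unlock. Qed.

Lemma measurable_expR_sqr : measurable_fun setT (fun w => (expR (X w ^+ 2 / (8 * v)))%:E).
Proof.
apply/measurable_EFinP; apply: measurableT_comp => //.
by apply: measurable_funM => //; exact: measurable_funX.
Qed.

(** A variable of mean square 1 cannot have a small sub-Gaussian parameter: compare
[X ^ 2 / (8 v)] with its exponential.  This absorbs the centering term [1] into
multiples of [v] below. *)
Lemma subgaussian_parameter_lb : (8 * v)^-1 <= C0.
Proof.
rewrite -lee_fin; apply: le_trans expectation_expR_sqr.
rewrite -[leLHS]mul1e -[X in (X * _)%E]integral_sqr1 -ge0_integralZr//; last 3 first.
- by apply/measurable_EFinP; exact: measurable_funX.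
- by move=> w _; rewrite lee_fin sqr_ge0.
- by rewrite lee_fin invr_ge0 mulr_ge0// ltW.
apply: ge0_le_integral => //.
- by move=> w _; rewrite -EFinM lee_fin mulr_ge0 ?sqr_ge0// invr_ge0 mulr_ge0// ltW.
- by apply: emeasurable_funM => //; apply/measurable_EFinP; exact: measurable_funX.
- exact: measurable_expR_sqr.
- move=> w _; rewrite -EFinM lee_fin; apply: le_trans (expR_ge1Dx _).
  by rewrite lerDr.
Qed.

Definition centered_sqr_cst : R := 512 * expR C0 * C0.

(** The linear term of the expansion of the exponential has mean zero, and the
quadratic remainder is dominated by [v ^ 2 exp (X ^ 2 / (8 v))], whose mean is
bounded by a universal constant. *)
Lemma centered_sqr_mgf (s : R) : `|s| <= (16 * v)^-1 ->
  (\int[P]_w (expR (s * (X w ^+ 2 - 1)))%:E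
    <= (expR (centered_sqr_cst * (s ^+ 2 * v ^+ 2)))%:E)%E.
Proof.
move=> sv.
pose B := 512 * (s ^+ 2 * v ^+ 2) * expR (8 * v)^-1.
(* The constant 512 is [2 * 256]: [(X^2 + 1)^2 = 256 v^2 y^2] and
  [y^2 <= 2 exp y], with [y] as below. *)
have sv0 : 0 <= 512 * (s ^+ 2 * v ^+ 2).
  by apply: mulr_ge0; [exact: ler0n|apply: mulr_ge0; exact: sqr_ge0].
have B0 : 0 <= B by rewrite mulr_ge0 ?expR_ge0.
have bnd w : expR (s * (X w ^+ 2 - 1)) <=
    1 + s * (X w ^+ 2 - 1) + B * expR (X w ^+ 2 / (8 * v)).
  apply: le_trans (expR_le_quadratic _) _; rewrite lerD2l /B.
  set x := X w; pose y := (x ^+ 2 + 1) / (16 * v).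
  have x0 : 0 <= x ^+ 2 by exact: sqr_ge0.
  have y0 : 0 <= y by rewrite divr_ge0 ?mulr_ge0 ?addr_ge0// ltW.
  have xy : `|s * (x ^+ 2 - 1)| <= y.
    rewrite normrM /y mulrC ler_pM//.
    by rewrite ler_norml; apply/andP; split; lra.
  have y2 : y ^+ 2 <= 2 * expR y.
    by have := @expR_ge1Dxn _ y 1 y0; rewrite -[2`!]/2%N; lra.
  have ye : expR (8 * v)^-1 * expR (x ^+ 2 / (8 * v)) = expR y * expR y.
    rewrite -!expRD; congr expR; rewrite /y; field; exact: lt0r_neq0.
  rewrite -[leRHS]mulrA ye.
  have -> : (s * (x ^+ 2 - 1)) ^+ 2 = s ^+ 2 * (x ^+ 2 - 1) ^+ 2 by ring.
  have -> : 512 * (s ^+ 2 * v ^+ 2) * (expR y * expR y) =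
    s ^+ 2 * (256 * v ^+ 2 * (2 * expR y) * expR y) by ring.
  rewrite -mulrA ler_wpM2l ?sqr_ge0// ler_pM ?sqr_ge0 ?expR_ge0 ?ler_expR//.
  apply: (@le_trans _ _ (256 * v ^+ 2 * y ^+ 2)); last first.
    by apply: ler_wpM2l y2; apply: mulr_ge0; [exact: ler0n|exact: sqr_ge0].
  have -> : 256 * v ^+ 2 * y ^+ 2 = (x ^+ 2 + 1) ^+ 2.
    by rewrite /y; field; exact: lt0r_neq0.
  nra.
have mX2 : measurable_fun setT (fun w => X w ^+ 2) by exact: measurable_funX.
have i2 : P.-integrable setT (fun w => (s * (X w ^+ 2 - 1))%:E).
  under eq_fun do rewrite EFinM EFinB.
  apply: integrableZl => //; apply: integrableB => //; first exact: (integrable_sqr mX X2).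
  exact: finite_measure_integrable_cst.
have ie : P.-integrable setT (fun w => (expR (X w ^+ 2 / (8 * v)))%:E).
  apply/integrableP; split; first exact: measurable_expR_sqr.
  under eq_integral do rewrite gee0_abs ?lee_fin ?expR_ge0//.
  exact: le_lt_trans expectation_expR_sqr (ltry _).
have i1 : P.-integrable setT (fun _ : T => 1%:E).
  exact: finite_measure_integrable_cst.
apply: (@le_trans _ _ (\int[P]_w
    (1%:E + (s * (X w ^+ 2 - 1))%:E + B%:E * (expR (X w ^+ 2 / (8 * v)))%:E))%E).
  apply: ge0_le_integral => //.
  - apply/measurable_EFinP; apply: measurableT_comp => //.
    by apply: measurable_funM => //; exact: measurable_funB.
  - exact: (measurable_int _ (integrableD measurableT
      (integrableD measurableT i1 i2) (integrableZl measurableT B ie))).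
  - by move=> w _; rewrite -EFinM -!EFinD lee_fin.
rewrite integralD//; [|exact: integrableD|exact: integrableZl].
rewrite integralD// integralZl// integral_cst//= probability_setT mule1.
have -> : (\int[P]_w (s * (X w ^+ 2 - 1))%:E = 0)%E.
  under eq_integral do rewrite EFinM EFinB.
  rewrite integralZl//; last first.
    by apply: integrableB => //; exact: (integrable_sqr mX X2).
  rewrite integralB//; last exact: (integrable_sqr mX X2).
  by rewrite integral_sqr1 integral_cst//= probability_setT mule1 subee// mule0.
rewrite adde0; apply: (@le_trans _ _ (1%:E + B%:E * C0%:E)%E).
  by rewrite leeD2l// lee_wpmul2l ?lee_fin//; exact: expectation_expR_sqr.
rewrite -EFinM -EFinD lee_fin; apply: le_trans (expR_ge1Dx _); rewrite lerD2l.
rewrite /B /centered_sqr_cst.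
set z := s ^+ 2 * v ^+ 2 in sv0 *.
have -> : 512 * z * expR (8 * v)^-1 * C0 = 512 * z * C0 * expR (8 * v)^-1.
  by ring.
have -> : 512 * expR C0 * C0 * z = 512 * z * C0 * expR C0 by ring.
apply: ler_wpM2l; last by rewrite ler_expR subgaussian_parameter_lb.
by apply: mulr_ge0; [exact: sv0|exact: ltW subgauss_sqr_cst_gt0].
Qed.

End SubgaussianSquare.

Lemma exp_markov (R : realType) (disp : measure_display)
    (T : measurableType disp) (P : probability T R) (f : T -> R) :
  measurable_fun setT f ->
  (P [set w | (0 <= f w)%R] <= \int[P]_w (expR (f w))%:E)%E.
Proof.
move=> mf; set A := [set w | _].
have mA : measurable A.
  rewrite -[A]setTI; apply: (measurable_fun_ler _ mf) => //.
have me : measurable_fun setT (fun w => (expR (f w))%:E).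
  by apply/measurable_EFinP; exact: measurableT_comp.
rewrite -[A]setIT -integral_indic//; apply: ge0_le_integral => //.
- by apply/measurable_EFinP; exact: measurable_indic.
- move=> w _; rewrite lee_fin indicE; case: (boolP (w \in A)) => [|_].
    by rewrite inE => fw; rewrite -expR0 ler_expR.
  exact: expR_ge0.
Qed.

(** * Bernstein bound for a fixed direction *)

Section WeightedChiSquare.
Context (R : realType) (disp : measure_display) (T : measurableType disp).
Variable P : probability T R.
Variables (n d : nat) (v : R) (lam : 'rV[R]_d).
Variable Z : 'I_n -> 'I_d -> {RV P >-> R}.
Hypothesis v0 : 0 < v.
Hypothesis lam0 : forall j, 0 < lam 0 j.
Hypothesis HZ : independent_entries v Z.
Hypothesis d0 : (0 < d)%N.

Let X (k : 'I_n * 'I_d) : T -> R := Z k.1 k.2.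

Lemma measurable_entry k : measurable_fun setT (X k).
Proof. exact: measurable_funP. Qed.

Definition proj_entry (u : 'I_n -> R) (j : 'I_d) (w : T) : R :=
  \sum_(i < n) u i * Z i j w.

Lemma l1_normE : l1_norm lam = \sum_(j < d) lam 0 j.
Proof. by apply: eq_bigr => j _; rewrite gtr0_norm. Qed.

Lemma l2_norm_sqr : l2_norm lam ^+ 2 = \sum_(j < d) lam 0 j ^+ 2.
Proof. by rewrite sqr_sqrtr// sumr_ge0// => j _; exact: sqr_ge0. Qed.

Lemma le_linf_norm j : lam 0 j <= linf_norm lam.
Proof.
by rewrite -(gtr0_norm (lam0 j)); exact: (le_bigmax _ (fun j => `|lam 0 j|)).
Qed.

Let j0 : 'I_d := Ordinal d0.

Lemma l1_norm_gt0 : 0 < l1_norm lam.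
Proof.
by rewrite l1_normE (bigD1 j0)//= ltr_pwDl// sumr_ge0// => j _; exact: ltW.
Qed.

Lemma linf_norm_gt0 : 0 < linf_norm lam.
Proof. exact: lt_le_trans (lam0 j0) (le_linf_norm j0). Qed.

Lemma l2_norm_sqr_gt0 : 0 < l2_norm lam ^+ 2.
Proof.
rewrite l2_norm_sqr (bigD1 j0)//= ltr_pwDl ?exprn_gt0// sumr_ge0// => j _.
exact: sqr_ge0.
Qed.

Lemma proj_entryE u j w :
  proj_entry u j w =
  \sum_(k <- [seq (i, j) | i <- enum 'I_n]) u k.1 * X k w.
Proof. by rewrite big_map big_enum. Qed.

Lemma uniq_column (j : 'I_d) : uniq [seq (i, j) | i <- enum 'I_n].
Proof. by rewrite map_inj_uniq ?enum_uniq// => i i' []. Qed.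

Lemma measurable_proj_entry_col u j :
  measurable_fun [set: salg [set f | exists2 k, k \in [set k | k.2 == j]%SET & f = X k]]
    (proj_entry u j).
Proof.
apply: (@measurable_sum _ (salg _)) => i; apply: measurable_funM => //.
by apply: sigma_of_gen; exists (i, j) => //; rewrite inE.
Qed.

Lemma measurable_proj_entry u j : measurable_fun setT (proj_entry u j).
Proof. by apply: measurable_sum => i; exact: measurable_funM. Qed.

Variable u : 'I_n -> R.
Hypothesis u1 : \sum_i u i ^+ 2 = 1.

Lemma subgaussian_proj j : subgaussian P v (proj_entry u j).
Proof.
move=> t; rewrite unlock.
have [Zind Zm] := HZ.
under eq_integral do rewrite proj_entryE mulr_sumr.
under eq_integral do under eq_bigr do rewrite mulrA.
apply: le_trans (mgf_lin_comb (X := X) (v := v) measurable_entry Zind _ _ _) _.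
- by move=> k; have [] := Zm k.1 k.2.
- exact: uniq_column.
- rewrite lee_fin ler_expR big_map big_enum/=.
  under eq_bigr do rewrite exprMn.
  by rewrite -mulr_sumr u1 mulr1.
Qed.

Lemma second_moment_proj j : ('E_P[fun w => (proj_entry u j w ^+ 2)%R] = 1)%E.
Proof.
rewrite unlock; have [Zind Zm] := HZ.
under eq_integral do rewrite proj_entryE.
rewrite (second_moment_lin_comb (X := X) measurable_entry Zind).
- by rewrite big_map big_enum/= u1.
- by move=> k; have [] := Zm k.1 k.2.
- by move=> k; have [] := Zm k.1 k.2.
- exact: uniq_column.
Qed.

Notation C1 := (centered_sqr_cst R).

Lemma weighted_sqr_mgf (th : R) : `|th| * linf_norm lam <= (16 * v)^-1 ->
  (\int[P]_w (expR (\sum_(j < d) th * lam 0 j * (proj_entry u j w ^+ 2 - 1)))%:E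
   <= (expR (C1 * (th ^+ 2 * v ^+ 2 * l2_norm lam ^+ 2)))%:E)%E.
Proof.
move=> thL; have [Zind Zm] := HZ.
under eq_integral do rewrite expR_sum.
pose g j w := expR (th * lam 0 j * (proj_entry u j w ^+ 2 - 1)).
rewrite -[X in (X <= _)%E]/(\int[P]_w (\prod_(j <- index_enum 'I_d) g j w)%:E)%E.
rewrite (expectation_prod_groups (X := X) measurable_entry Zind (p := snd)).
- rewrite l2_norm_sqr !mulr_sumr; apply: prode_le_expR_sum => j.
  rewrite integral_ge0/=; last by move=> w _; rewrite lee_fin expR_ge0.
  have -> : C1 * (th ^+ 2 * v ^+ 2 * lam 0 j ^+ 2) =
    C1 * ((th * lam 0 j) ^+ 2 * v ^+ 2) by ring.
  apply: (centered_sqr_mgf v0 (measurable_proj_entry u j)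
    (subgaussian_proj j) (second_moment_proj j)).
  apply: le_trans thL; rewrite normrM (gtr0_norm (lam0 j)).
  by rewrite ler_wpM2l// le_linf_norm.
- exact: index_enum_uniq.
- move=> j; apply: measurableT_comp => //; apply: measurable_funM => //.
  apply: measurable_funB => //; apply: measurable_funX.
  exact: measurable_proj_entry_col.
- by move=> j w; exact: expR_ge0.
Qed.

Definition net_rate : R := (256 * C1)^-1.

Lemma centered_sqr_cst_ge1 : 1 <= C1.
Proof.
rewrite /centered_sqr_cst /subgauss_sqr_cst.
have : 1 <= expR (4 * expR 2) :> R by rewrite -expR0 ler_expR mulr_ge0 ?expR_ge0.
have : 1 <= expR 2 :> R by rewrite -expR0 ler_expR.
nra.
Qed.

(** Chernoff's bound with the exponent chosen as the smaller of the unconstrained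
optimum and the largest value for which [weighted_sqr_mgf] applies; these two
cases produce the two terms of the minimum. *)
Lemma weighted_sqr_tail (sg : R) : `|sg| = 1 ->
  (P [set w | (l1_norm lam / 8
       <= sg * \sum_(j < d) lam 0 j * (proj_entry u j w ^+ 2 - 1))%R]
   <= (expR (- net_rate * Num.min (d_2 lam / v ^+ 2) (d_inf lam / v)))%:E)%E.
Proof.
move=> sg1.
have C1_ge1 := centered_sqr_cst_ge1.
have C10 : 0 < C1 by exact: lt_le_trans C1_ge1.
have L0 := l1_norm_gt0; have Li0 := linf_norm_gt0; have L20 := l2_norm_sqr_gt0.
set L := l1_norm lam in L0 *; set Li := linf_norm lam in Li0 *.
pose S2 := l2_norm lam ^+ 2; rewrite -/S2 in L20.
(* [a] minimizes the Chernoff exponent; [b] is the admissible limit. *)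
pose a := L / (16 * (C1 * v ^+ 2 * S2)); pose b := (16 * v * Li)^-1.
pose th := Num.min a b.
have vv0 : 0 < v ^+ 2 by rewrite exprn_gt0.
have CvS : 0 < C1 * v ^+ 2 * S2.
  by apply: mulr_gt0 => //; exact: mulr_gt0.
have a0 : 0 < a.
  by apply: divr_gt0 => //; exact: mulr_gt0.
have b0 : 0 < b by rewrite invr_gt0 !mulr_gt0.
have th0 : 0 < th by rewrite lt_min a0.
pose f w := \sum_(j < d) (sg * th) * lam 0 j * (proj_entry u j w ^+ 2 - 1)
            - th * (L / 8).
have fE w : f w = th * (sg * (\sum_(j < d) lam 0 j * (proj_entry u j w ^+ 2 - 1))
                        - L / 8).
  rewrite /f mulrBr; congr (_ - _); rewrite !mulr_sumr.
  by apply: eq_bigr => j _; ring.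
have mS : measurable_fun setT
    (fun w => \sum_(j < d) (sg * th) * lam 0 j * (proj_entry u j w ^+ 2 - 1)).
  apply: measurable_sum => j; apply: measurable_funM => //.
  by apply: measurable_funB => //; apply: measurable_funX; exact: measurable_proj_entry.
have mf : measurable_fun setT f by exact: measurable_funB.
rewrite (_ : [set w | _] = [set w | (0 <= f w)%R]); last first.
  by apply/seteqP; split=> w /=; rewrite fE pmulr_rge0// subr_ge0.
apply: le_trans (exp_markov P mf) _.
under eq_integral do rewrite /f expRD EFinM.
have mE : measurable_fun setT (fun w => (expR (\sum_(j < d)
    (sg * th) * lam 0 j * (proj_entry u j w ^+ 2 - 1)))%:E).
  by apply/measurable_EFinP; exact: measurableT_comp.
rewrite ge0_integralZr ?lee_fin ?expR_ge0//.
have H : `|sg * th| * Li <= (16 * v)^-1.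
  rewrite normrM sg1 mul1r gtr0_norm//.
  apply: (@le_trans _ _ (b * Li)); first by rewrite ler_wpM2r ?(ltW Li0)// ge_min lexx orbT.
  by rewrite /b invfM mulfVK// gt_eqF.
apply: le_trans (lee_wpmul2r _ (weighted_sqr_mgf H)) _.
  by rewrite lee_fin expR_ge0.
rewrite -EFinM -expRD lee_fin ler_expR -/S2.
have -> : (sg * th) ^+ 2 = th ^+ 2 by rewrite exprMn -real_normK ?num_real// sg1 expr1n mul1r.
have tha : th <= a by rewrite ge_min lexx.
have h1 : C1 * (th ^+ 2 * v ^+ 2 * S2) <= th * (L / 16).
  have -> : C1 * (th ^+ 2 * v ^+ 2 * S2) = th * (th * (C1 * v ^+ 2 * S2)) by ring.
  rewrite ler_wpM2l ?(ltW th0)//.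
  apply: (@le_trans _ _ (a * (C1 * v ^+ 2 * S2))).
    by rewrite ler_wpM2r// ltW.
  by rewrite /a le_eqVlt; apply/orP; left; apply/eqP; field; rewrite !gt_eqF.
apply: (@le_trans _ _ (- (th * (L / 16)))); first lra.
rewrite mulNr lerN2 /net_rate /d_2 /d_inf -/L -/Li -/S2 /th.
set p := L ^+ 2 / S2 / v ^+ 2; set q := L / Li / v.
have r1 : 0 < 256 * C1 by apply: mulr_gt0 => //; rewrite ltr0n.
have r0 : 0 <= (256 * C1)^-1 by rewrite invr_ge0; exact: ltW.
case: (leP a b) => _.
  apply: (@le_trans _ _ ((256 * C1)^-1 * p)).
    by rewrite ler_wpM2l// ge_min lexx.
  rewrite le_eqVlt; apply/orP; left; apply/eqP; rewrite /p /a; field.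
  by rewrite !gt_eqF.
apply: (@le_trans _ _ ((256 * C1)^-1 * q)).
  by rewrite ler_wpM2l// ge_min lexx orbT.
have -> : b * (L / 16) = 256^-1 * q.
  by rewrite /b /q; field; rewrite !gt_eqF.
rewrite ler_wpM2r//; first by rewrite !divr_ge0// ltW.
by rewrite lef_pV2 ?posrE ?ltr0n //; lra.
Qed.

End WeightedChiSquare.

(** * A lattice net for quadratic forms *)

Section LatticeNet.
Context (R : realType).

(** The value at [x] of the quadratic form of K - L, where K is the Gram matrix with
entries [\sum_j lam_j z_ij z_kj] and L is the sum of the weights. *)
Definition quad_dev (n d : nat) (lam : 'rV[R]_d) (z : 'I_n -> 'I_d -> R)
    (x : 'I_n -> R) : R :=
  \sum_(j < d) lam 0 j * ((\sum_i x i * z i j) ^+ 2 - \sum_i x i ^+ 2).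

Section Deterministic.
Variables (n d : nat) (lam : 'rV[R]_d) (z : 'I_n -> 'I_d -> R).
Hypothesis n0 : (0 < n)%N.
Notation q := (quad_dev lam z).

Lemma quad_devZ c x : q (fun i => c * x i) = c ^+ 2 * q x.
Proof.
rewrite /quad_dev mulr_sumr; apply: eq_bigr => j _.
under eq_bigr do rewrite -mulrA.
under [X in _ - X]eq_bigr do rewrite exprMn.
by rewrite -!mulr_sumr; ring.
Qed.

(** Polarization.  The factors 1/3 and 3 balance the two arguments for the intended
use, where [x + y] is about nine times as long as [x - y]. *)
Lemma quad_dev_diff x y :
  q x - q y = 4^-1 * (q (fun i => (x i + y i) / 3 + 3 * (x i - y i))
                    - q (fun i => (x i + y i) / 3 - 3 * (x i - y i))).
Proof.
rewrite /quad_dev -!sumrB mulr_sumr; apply: eq_bigr => j _.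
have sE (a b : R) : \sum_i (a * x i + b * y i) ^+ 2 =
    a ^+ 2 * (\sum_i x i ^+ 2) + 2 * a * b * (\sum_i x i * y i)
    + b ^+ 2 * \sum_i y i ^+ 2.
  by rewrite !mulr_sumr -!big_split /=; apply: eq_bigr => i _; ring.
have lE (a b : R) : \sum_i (a * x i + b * y i) * z i j =
    a * (\sum_i x i * z i j) + b * \sum_i y i * z i j.
  by rewrite !mulr_sumr -!big_split /=; apply: eq_bigr => i _; ring.
have e1 i : (x i + y i) / 3 + 3 * (x i - y i) = (10 / 3) * x i + (- 8 / 3) * y i.
  by field.
have e2 i : (x i + y i) / 3 - 3 * (x i - y i) = (- 8 / 3) * x i + (10 / 3) * y i.
  by field.
under [X in _ = _ * (_ * (X ^+ 2 - _) - _)]eq_bigr do rewrite e1.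
under [X in _ = _ * (_ * (_ - X) - _)]eq_bigr do rewrite e1.
under [X in _ = _ * (_ - _ * (X ^+ 2 - _))]eq_bigr do rewrite e2.
under [X in _ = _ * (_ - _ * (_ - X))]eq_bigr do rewrite e2.
by rewrite !sE !lE; field.
Qed.

(** Cauchy-Schwarz. *)
Lemma sqr_sum_le (a b : 'I_n -> R) :
  (\sum_i a i * b i) ^+ 2 <= (\sum_i a i ^+ 2) * \sum_i b i ^+ 2.
Proof.
have -> : (\sum_i a i ^+ 2) * (\sum_i b i ^+ 2) =
    \sum_i \sum_k 2^-1 * (a i ^+ 2 * b k ^+ 2 + a k ^+ 2 * b i ^+ 2).
  under [RHS]eq_bigr do rewrite -mulr_sumr big_split/= -mulr_sumr -mulr_suml.
  by rewrite -mulr_sumr big_split/= -mulr_suml -mulr_sumr; field.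
rewrite expr2 mulr_suml; apply: ler_sum => i _.
rewrite mulr_sumr; apply: ler_sum => k _.
have := sqr_ge0 (a i * b k - a k * b i); nra.
Qed.

(** A crude bound, only there to make the best constant finite in [quad_dev_le]. *)
Lemma quad_dev_bounded : exists2 B : R, 0 <= B &
  forall x, `|q x| <= B * \sum_i x i ^+ 2.
Proof.
exists (\sum_j `|lam 0 j| * ((\sum_i z i j ^+ 2) + 1)).
  apply: sumr_ge0 => j _; rewrite mulr_ge0// addr_ge0// sumr_ge0// => i _.
  exact: sqr_ge0.
move=> x; apply: le_trans (ler_norm_sum _ _ _) _; rewrite mulr_suml.
apply: ler_sum => j _; rewrite normrM -[leRHS]mulrA ler_wpM2l//.
apply: le_trans (ler_normB _ _) _.
have x0 : 0 <= \sum_i x i ^+ 2 by rewrite sumr_ge0// => i _; exact: sqr_ge0.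
rewrite (ger0_norm (sqr_ge0 _)) (ger0_norm x0) mulrDl mul1r lerD2r mulrC.
exact: sqr_sum_le.
Qed.

Variable eta : R.
Hypothesis eta0 : 0 <= eta.
Hypothesis net : forall k : 'I_n -> int,
  \sum_i (k i)%:~R ^+ 2 <= (25 * n)%:R :> R ->
  `|q (fun i => (k i)%:~R)| <= eta * \sum_i (k i)%:~R ^+ 2.

(** Round a vector of length [4 sqrt n] down to an integer vector: the rounding error
has length at most [sqrt n], so the integer vector has length at most [5 sqrt n]. *)
Lemma quad_dev_round (M : R) (x : 'I_n -> R) : 0 <= M ->
  (forall y, `|q y| <= M * \sum_i y i ^+ 2) ->
  \sum_i x i ^+ 2 = (16 * n)%:R -> `|q x| <= (25 * eta + 9 * M) * n%:R.
Proof.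
move=> M0 qM xn.
pose k i := Num.floor (x i); pose r i := x i - (k i)%:~R.
have r01 i : 0 <= r i <= 1.
  have := floor_itv (x i); rewrite intrD /r => /andP[h1 h2].
  by rewrite subr_ge0 h1/= lerBlDl ltW.
have r2 : \sum_i r i ^+ 2 <= n%:R.
  have -> : n%:R = \sum_(i < n) (1 : R) by rewrite sumr_const card_ord.
  apply: ler_sum => i _.
  by have := r01 i; nra.
have n2 m : (m * n)%:R = m%:R * n%:R :> R by rewrite natrM.
(* The inequality [(a - b)^2 <= 5/4 a^2 + 5 b^2] balances the lengths 4 and 1 into 5. *)
have kn : \sum_i (k i)%:~R ^+ 2 <= (25 * n)%:R :> R.
  apply: (@le_trans _ _ (\sum_i (5 / 4 * x i ^+ 2 + 5 * r i ^+ 2))).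
    apply: ler_sum => i _; have := sqr_ge0 (x i / 2 + 2 * r i).
    by rewrite /r; nra.
  by rewrite big_split/= -!mulr_sumr xn !n2; lra.
have qk : `|q (fun i => (k i)%:~R)| <= 25 * eta * n%:R.
  apply: le_trans (net kn) _; rewrite [25 * _]mulrC -mulrA ler_wpM2l//.
  by move: kn; rewrite n2.
have pE : \sum_i ((x i + (k i)%:~R) / 3 + 3 * (x i - (k i)%:~R)) ^+ 2
     + \sum_i ((x i + (k i)%:~R) / 3 - 3 * (x i - (k i)%:~R)) ^+ 2 <= 36 * n%:R.
  rewrite -big_split/=.
  apply: (@le_trans _ _ (\sum_i (x i ^+ 2 + 20 * r i ^+ 2))).
    apply: ler_sum => i _; have := sqr_ge0 (x i / 3 + 4 / 3 * r i).
    rewrite /r; nra.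
  by rewrite big_split/= -!mulr_sumr xn !n2; lra.
have := quad_dev_diff x (fun i => (k i)%:~R).
set A := q (fun i => _ + _); set B := q (fun i => _ - _) => e.
(* Together the two arguments of the form have squared length at most [36 n]. *)
have hA : `|A| <= _ := qM _; have hB : `|B| <= _ := qM _.
have : `|q x - q (fun i => (k i)%:~R)| <= 9 * M * n%:R.
  rewrite e normrM ger0_norm ?invr_ge0//.
  have := ler_normB A B; nra.
have := ler_normD (q x - q (fun i => (k i)%:~R)) (q (fun i => (k i)%:~R)).
rewrite subrK; lra.
Qed.

(** A bound [M] on the form yields the bound [(25 eta + 9 M) / 16], by rescaling to the
length required by [quad_dev_round]. *)
Lemma quad_dev_contract (M : R) : 0 <= M ->
  (forall y, `|q y| <= M * \sum_i y i ^+ 2) ->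
  forall x, `|q x| <= (25 * eta + 9 * M) / 16 * \sum_i x i ^+ 2.
Proof.
move=> M0 qM x; set s := \sum_i _.
have s0 : 0 <= s by rewrite sumr_ge0// => i _; exact: sqr_ge0.
have [s_eq0|s_neq0] := eqVneq s 0.
  by have := qM x; rewrite -/s s_eq0 !mulr0.
have sp : 0 < s by rewrite lt_def s_neq0.
pose c2 := (16 * n)%:R / s; pose c := Num.sqrt c2.
have nR : 0 < n%:R :> R by rewrite ltr0n.
have c20 : 0 < c2 by rewrite divr_gt0// natrM mulr_gt0.
have cE : c ^+ 2 = c2 by rewrite sqr_sqrtr// ltW.
have := @quad_dev_round M (fun i => c * x i) M0 qM.
rewrite quad_devZ cE normrM (gtr0_norm c20).
under eq_bigr do rewrite exprMn.
rewrite -mulr_sumr cE -/s /c2 divfK// => /(_ erefl).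
rewrite mulrC -ler_pdivlMr ?divr_gt0 ?natrM ?mulr_gt0// => h.
apply: le_trans h _; rewrite le_eqVlt; apply/orP; left; apply/eqP.
by field; rewrite !gt_eqF.
Qed.

(** The best bound [m] is not improved by [quad_dev_contract], so
[16 m <= 25 eta + 9 m]. *)
Lemma quad_dev_le x : `|q x| <= 4 * eta * \sum_i x i ^+ 2.
Proof.
pose S := [set M : R | 0 <= M /\ forall y, `|q y| <= M * \sum_i y i ^+ 2].
have [B B0 qB] := quad_dev_bounded.
have lbS : lbound S 0 by move=> M [].
have hS : has_inf S by split; [exists B|exists 0].
pose m := inf S.
have m0 : 0 <= m by apply: lb_le_inf => //; exists B.
have qm y : `|q y| <= m * \sum_i y i ^+ 2.
  set s := \sum_i _.
  have s0 : 0 <= s by rewrite sumr_ge0// => i _; exact: sqr_ge0.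
  have [s_eq0|s_neq0] := eqVneq s 0.
    by have := qB y; rewrite -/s s_eq0 !mulr0.
  have sp : 0 < s by rewrite lt_def s_neq0.
  rewrite -ler_pdivrMr//; apply: lb_le_inf; first by exists B.
  by move=> M [_ /(_ y)]; rewrite ler_pdivrMr.
have : m <= (25 * eta + 9 * m) / 16.
  apply: ge_inf; first by exists 0.
  by split; [rewrite divr_ge0// addr_ge0// mulr_ge0|exact: quad_dev_contract].
move=> hm; apply: le_trans (qm x) _; rewrite ler_wpM2r//.
  by rewrite sumr_ge0// => i _; exact: sqr_ge0.
lra.
Qed.

End Deterministic.

(** Integer vectors with coordinates between [- 25 n] and [25 n], as a finite type. *)
Definition lattice_pt (n : nat) (f : {ffun 'I_n -> 'I_(50 * n).+1}) (i : 'I_n)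
  : R := (f i)%:R - (25 * n)%:R.

(** The integer points of the ball of radius [5 sqrt n]. *)
Definition lattice_net (n : nat) : {set {ffun 'I_n -> 'I_(50 * n).+1}} :=
  [set f | \sum_i lattice_pt f i ^+ 2 <= (25 * n)%:R]%SET.

Lemma int_sqr_le_coord (n : nat) (k : 'I_n -> int) (m : nat) :
  \sum_i (k i)%:~R ^+ 2 <= m%:R :> R -> forall i, (`|k i| <= m)%N.
Proof.
move=> km i; rewrite -(ler_nat R); apply: le_trans km.
rewrite (bigD1 i)//=; apply: (@le_trans _ _ ((k i)%:~R ^+ 2)); last first.
  by rewrite lerDl sumr_ge0// => j _; exact: sqr_ge0.
rewrite -(real_normK (num_real _)) -intr_norm.
rewrite -natr_absz -natrX ler_nat; case: `|k i|%N => // p.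
by rewrite expnS leq_pmulr.
Qed.

(** An integer is at most its square in absolute value, so the points of the ball
have coordinates in the range of [lattice_pt]. *)
Lemma lattice_netP (n : nat) (k : 'I_n -> int) :
  \sum_i (k i)%:~R ^+ 2 <= (25 * n)%:R :> R ->
  exists2 f, f \in lattice_net n & (fun i => (k i)%:~R) = lattice_pt f.
Proof.
move=> kn; have kb := int_sqr_le_coord kn.
have fP i : (`|(k i + (25 * n)%:Z)%R| < (50 * n).+1)%N.
  have := kb i; lia.
pose f : {ffun 'I_n -> 'I_(50 * n).+1} := [ffun i => Ordinal (fP i)].
have kE : (fun i => (k i)%:~R) = lattice_pt f.
  apply/funext => i; rewrite /lattice_pt ffunE /=.
  have h : (0 <= k i + (25 * n)%:Z) by have := kb i; lia.
  rewrite natr_absz ger0_norm// intrD; lra.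
by exists f => //; rewrite inE -kE.
Qed.

(** [2 ^ (- |a - m|)]. *)
Definition lattice_weight (m a : nat) : R := (2^-1) ^+ ((a - m) + (m - a)).

Lemma sum_lattice_weight_le (m : nat) :
  \sum_(a < (m + m).+1) lattice_weight m a <= 4.
Proof.
rewrite -(big_mkord xpredT (lattice_weight m)) (@big_cat_nat _ _ _ m)//=;
  last by rewrite leqW// leq_addr.
rewrite (_ : 4 = 2 + 2); last by ring.
apply: lerD.
  rewrite big_nat_rev/= add0n.
  apply: le_trans (sum_pow_half_le R m).
  rewrite !big_mkord; apply: ler_sum => i _; rewrite /lattice_weight.
  apply: ler_wiXn2l; rewrite ?invr_ge0 ?invf_le1//; first by rewrite ler1n.
  have := ltn_ord i; lia.
rewrite -{1}[m]add0n big_addn; apply: le_trans (sum_pow_half_le R ((m + m).+1 - m)).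
by apply: ler_sum => i _; rewrite /lattice_weight addnK (_ : m - _ = 0)%N ?addn0//; lia.
Qed.

(** Exponential weights: a point of the ball has [\sum_i |k_i| <= \sum_i k_i ^ 2 <= 25 n],
so its weight is at least [2 ^ (- 25 n)], while all weights together sum to at
most [4 ^ n]. *)
Lemma card_lattice_net (n : nat) : #|lattice_net n|%:R <= (2 ^+ 27) ^+ n :> R.
Proof.
pose w (a : 'I_(50 * n).+1) := lattice_weight (25 * n) a.
have w0 a : 0 <= w a by rewrite /w /lattice_weight exprn_ge0// invr_ge0.
have hw f : f \in lattice_net n -> 1 <= (2 ^+ 25) ^+ n * \prod_i w (f i).
  rewrite inE => hf; rewrite /w /lattice_weight -expr_sum -exprM exprVn.
  rewrite ler_pdivlMr ?exprn_gt0// mul1r ler_eXn2l ?ltr1n//.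
  rewrite -(ler_nat R); apply: le_trans hf; rewrite natr_sum; apply: ler_sum => i _.
  rewrite /lattice_pt; set a := nat_of_ord _; set m := (25 * n)%N.
  have [am|am] := leqP m a.
    rewrite -natrB// -natrX ler_nat (_ : (m - a = 0)%N); last by lia.
    by rewrite addn0; case: (a - m)%N => // p; rewrite expnS leq_pmulr.
  rewrite -sqrrN opprB -natrB ?(ltnW am)// -natrX ler_nat.
  rewrite (_ : (a - m = 0)%N); last by lia.
  by rewrite add0n; case: (m - a)%N => // p; rewrite expnS leq_pmulr.
rewrite -sum1_card natr_sum.
apply: (@le_trans _ _ (\sum_(f : {ffun 'I_n -> 'I_(50 * n).+1})
    (2 ^+ 25) ^+ n * \prod_i w (f i))).
  rewrite big_mkcond/=; apply: ler_sum => f _; case: ifPn => [/hw//|_].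
  by rewrite mulr_ge0 ?exprn_ge0// prodr_ge0.
rewrite -mulr_sumr -(bigA_distr_bigA (fun _ => w))/=.
rewrite prodr_const card_ord.
have -> : (2 ^+ 27) ^+ n = (2 ^+ 25) ^+ n * 4 ^+ n :> R.
  by rewrite -exprMn -[4]/((2 * 2)%:R) natrM -expr2 -exprD.
rewrite ler_wpM2l ?exprn_ge0// lerXn2r ?nnegrE ?sumr_ge0//.
rewrite -(big_mkord xpredT (lattice_weight (25 * n))).
rewrite (_ : 50 * n = 25 * n + 25 * n)%N; last by rewrite -mulnDl.
by rewrite big_mkord; exact: sum_lattice_weight_le.
Qed.

End LatticeNet.

(** * Lower bound on the Gram matrix *)

Lemma boole_inequality_seq (R : realType) (disp : measure_display)
    (T : measurableType disp) (P : probability T R) (S : Type) (s : seq S)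
    (p : pred S) (A : S -> set T) :
  (forall i, p i -> measurable (A i)) ->
  (P (\big[setU/set0]_(i <- s | p i) A i) <= \sum_(i <- s | p i) P (A i))%E.
Proof.
move=> mA.
suff [] : measurable (\big[setU/set0]_(i <- s | p i) A i) /\
   (P (\big[setU/set0]_(i <- s | p i) A i) <= \sum_(i <- s | p i) P (A i))%E by [].
elim: s => [|i s [mU IH]] /=; first by rewrite !big_nil measure0.
rewrite !big_cons; case: ifPn => [pi|_] //=.
split; first by apply: measurableU => //; exact: mA.
by have := measureU2 P (mA _ pi) mU => /le_trans; apply; exact: leeD2l.
Qed.

Section GramConcentration.
Context (R : realType) (disp : measure_display) (T : measurableType disp).
Variable P : probability T R.
Variables (n d : nat) (v : R) (lam : 'rV[R]_d).
Variable Z : 'I_n -> 'I_d -> {RV P >-> R}.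
Hypothesis v0 : 0 < v.
Hypothesis lam0 : forall j, 0 < lam 0 j.
Hypothesis HZ : independent_entries v Z.
Hypothesis n0 : (0 < n)%N.
Hypothesis d0 : (0 < d)%N.

(** Union bound over the lattice of the deviations of more than [L / 8], followed by
[quad_dev_le] with [eta = L / 8]. *)
Lemma gram_concentration : exists G : set T,
  [/\ measurable G,
      (P (~` G) <= (expR (- net_rate R * Num.min (d_2 lam / v ^+ 2) (d_inf lam / v)
                    + 28 * n%:R))%:E)%E &
      forall w, G w -> forall x : 'I_n -> R,
        `|quad_dev lam (fun i j => Z i j w) x|
          <= l1_norm lam / 2 * \sum_i x i ^+ 2].
Proof.
set L := l1_norm lam.
have L0 : 0 < L by exact: l1_norm_gt0.
set E := - net_rate R * _.
pose lat (f : {ffun 'I_n -> 'I_(50 * n).+1}) : 'I_n -> R := lattice_pt R f.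
pose s f := \sum_i lat f i ^+ 2.
have s0 f : 0 <= s f by rewrite sumr_ge0// => i _; exact: sqr_ge0.
pose u f i := (Num.sqrt (s f))^-1 * lat f i.
pose S f w := \sum_(j < d) lam 0 j * (proj_entry Z (u f) j w ^+ 2 - 1).
pose B f (sg : R) := [set w | L / 8 <= sg * S f w].
pose p f := (f \in lattice_net R n) && (s f != 0).
have mS f : measurable_fun setT (S f).
  apply: measurable_sum => j; apply: measurable_funM => //.
  by apply: measurable_funB => //; apply: measurable_funX; exact: measurable_proj_entry.
have mB f sg : measurable (B f sg).
  rewrite -[B f sg]setTI; apply: (measurable_fun_ler (f := cst (L / 8))) => //.
  exact: measurable_funM.
have u1 f : s f != 0 -> \sum_i u f i ^+ 2 = 1.
  move=> sf; rewrite /u; under eq_bigr do rewrite exprMn.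
  by rewrite -mulr_sumr exprVn sqr_sqrtr// mulVf.
pose Bad := \big[setU/set0]_(f <- index_enum _ | p f) (B f 1 `|` B f (- 1)).
have mBad : measurable Bad.
  by apply: bigsetU_measurable => f _; exact: measurableU.
exists (~` Bad); split; first exact: measurableC.
- rewrite setCK; apply: (@le_trans _ _ ((2 * expR E) *+ count p (index_enum _))%:E).
    apply: le_trans.
      by apply: boole_inequality_seq => f _; exact: measurableU.
    rewrite -sum1_count -mulr_natl natr_sum mulr_suml -sumEFin.
    apply: lee_sum => f /andP[_ sf]; rewrite mul1r.
    have := measureU2 P (mB f 1) (mB f (- 1)).
    move=> /le_trans; apply; rewrite mulr_natl mulr2n EFinD.
    by apply: leeD; apply: (weighted_sqr_tail v0 lam0 HZ d0 (u1 _ sf));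
        rewrite ?normrN normr1.
  (* There are at most [2 ^ (27 n)] points and two signs, and [2 ^ (28 n) <= exp (28 n)]. *)
  rewrite lee_fin -mulr_natl expRD [leRHS]mulrC mulrA ler_wpM2r ?expR_ge0//.
  have cn : (count p (index_enum _))%:R <= (2 ^+ 27) ^+ n :> R.
    apply: le_trans (card_lattice_net R n).
    rewrite ler_nat -sum1_count -sum1_card big_mkcond [leqRHS]big_mkcond/=.
    by apply: leq_sum => f _; rewrite /p; case: (f \in _) => //=; case: ifP.
  apply: (@le_trans _ _ ((2 ^+ 27) ^+ n * 2)); first by rewrite ler_wpM2r.
  apply: (@le_trans _ _ ((2 ^+ 27) ^+ n * 2 ^+ n)).
    by rewrite ler_wpM2l ?exprn_ge0// -[leLHS]expr1 ler_eXn2l ?ltr1n.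
  rewrite -exprMn -exprSr -exprM -natrM -[(28 * n)%:R]mulr1 expRM_natl.
  rewrite lerXn2r ?nnegrE ?expR_ge0//.
  by have := expR_ge1Dx (1 : R); lra.
- move=> w Gw x.
  have -> : L / 2 = 4 * (L / 8) by field.
  apply: quad_dev_le => //; first by rewrite divr_ge0// ltW.
  move=> k /lattice_netP[f fn kE].
  have -> : \sum_i (k i)%:~R ^+ 2 = s f.
    by apply: eq_bigr => i _; rewrite /lat -kE.
  rewrite kE.
  (* The origin is the one lattice point that cannot be normalized. *)
  have [sf0|sf] := eqVneq (s f) 0.
    have [B0 _ /(_ (lat f))] := quad_dev_bounded lam (fun i j => Z i j w).
    by rewrite -/(s f) sf0 !mulr0.
  have NB sg : sg = 1 \/ sg = -1 -> sg * S f w < L / 8.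
    move=> sgE; rewrite ltNge; apply/negP => Bw; apply: Gw.
    rewrite /Bad -bigcup_seq_cond; exists f; first by rewrite /= mem_index_enum /p fn.
    by case: sgE Bw => ->; [left|right].
  have qE : quad_dev lam (fun i j => Z i j w) (lat f) = s f * S f w.
    rewrite /quad_dev /S mulr_sumr; apply: eq_bigr => j _.
    have -> : proj_entry Z (u f) j w =
        (Num.sqrt (s f))^-1 * \sum_i lat f i * Z i j w.
      by rewrite /proj_entry mulr_sumr; apply: eq_bigr => i _; rewrite mulrA.
    by rewrite exprMn exprVn sqr_sqrtr// -/(s f); field.
  rewrite -/(lat f) qE normrM (ger0_norm (s0 f)) mulrC ler_wpM2r//.
  rewrite ler_norml; apply/andP; split.
    by have := NB (-1) (or_intror erefl); lra.
  by have := NB 1 (or_introl erefl); lra.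
Qed.

End GramConcentration.

(** * The dual problem and leave-one-out interpolation *)

Section Dual.
Context (R : realType).

Definition sqnorm (p : nat) (u : 'cV[R]_p) : R := \sum_k u k 0 ^+ 2.

Lemma sqnormE p (u : 'cV[R]_p) : (u^T *m u) 0 0 = sqnorm u.
Proof. by rewrite mxE; apply: eq_bigr => k _; rewrite mxE expr2. Qed.

Lemma sqnorm_ge0 p (u : 'cV[R]_p) : 0 <= sqnorm u.
Proof. by apply: sumr_ge0 => k _; exact: sqr_ge0. Qed.

Lemma sqnorm_eq0 p (u : 'cV[R]_p) : sqnorm u = 0 -> u = 0.
Proof.
move=> /eqP; rewrite psumr_eq0 => [/allP u0|k _]; last exact: sqr_ge0.
apply/matrixP => k l; rewrite ord1 mxE; apply/eqP.
by rewrite -sqrf_eq0; exact: (u0 k (mem_index_enum _)).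
Qed.

Lemma det_neq0_ker p (A : 'M[R]_p) :
  (forall k : 'cV[R]_p, A *m k = 0 -> k = 0) -> \det A != 0.
Proof.
move=> kerA; rewrite -det_tr; apply/det0P => -[k k0 kA].
have : k^T = 0 by apply: kerA; rewrite -[LHS]trmxK trmx_mul trmxK kA trmx0.
by move/(congr1 trmx); rewrite trmxK trmx0 => k0'; rewrite k0' eqxx in k0.
Qed.

Lemma det_eq0_ker p (A : 'M[R]_p) : \det A = 0 ->
  exists2 k : 'cV[R]_p, k != 0 & A *m k = 0.
Proof.
rewrite -det_tr => /eqP/det0P[k k0 kA]; exists k^T.
  by apply: contra k0 => /eqP/(congr1 trmx); rewrite trmxK trmx0 => ->.
by rewrite -[LHS]trmxK trmx_mul trmxK kA trmx0.
Qed.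

Lemma mulmx_adj_inv p (A : 'M[R]_p) (b : 'cV[R]_p) : \det A != 0 ->
  A *m ((\det A)^-1 *: (\adj A *m b)) = b.
Proof.
by move=> dA; rewrite -scalemxAr mulmxA mul_mx_adj mul_scalar_mx scalerA mulVf//
  scale1r.
Qed.

Variables (n d : nat) (x : 'I_n -> 'cV[R]_d) (y : 'rV[R]_n).

Definition design : 'M[R]_(d, n) := \matrix_(k, i) x i k 0.

Lemma gramE : gram x = design^T *m design.
Proof.
apply/matrixP => i j; rewrite !mxE; apply: eq_bigr => k _; by rewrite !mxE.
Qed.

Lemma gram_entry i j : gram x i j = \sum_k x i k 0 * x j k 0.
Proof. by rewrite !mxE; apply: eq_bigr => k _; rewrite !mxE. Qed.

Let M := design *m diag_mx y.
Definition signed_gram : 'M[R]_n := (diag_mx y)^T *m gram x *m diag_mx y.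
Notation Q := signed_gram.

Lemma signed_gramE : Q = M^T *m M.
Proof. by rewrite /signed_gram gramE trmx_mul !mulmxA. Qed.

Lemma signed_gram_quad (a : 'cV[R]_n) : (a^T *m Q *m a) 0 0 = sqnorm (M *m a).
Proof. by rewrite signed_gramE -sqnormE (trmx_mul M a) !mulmxA. Qed.

Let one : 'cV[R]_n := const_mx 1.

Lemma objectiveE a :
  svm_dual_objective x y a = (a^T *m one) 0 0 - 2^-1 * sqnorm (M *m a).
Proof.
rewrite /svm_dual_objective -signed_gram_quad /signed_gram !mulmxA.
by congr (_ - _); rewrite mxE; apply: eq_bigr => i _; rewrite !mxE mulr1.
Qed.

Lemma sqnormD p (u h : 'cV[R]_p) t :
  sqnorm (u + t *: h) = sqnorm u + 2 * t * (h^T *m u) 0 0 + t ^+ 2 * sqnorm h.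
Proof.
rewrite /sqnorm [(h^T *m u) _ _]mxE !mulr_sumr -!big_split/=.
by apply: eq_bigr => k _; rewrite !mxE; ring.
Qed.

Lemma objectiveD a h t :
  svm_dual_objective x y (a + t *: h) = svm_dual_objective x y a
    + t * (h^T *m (one - Q *m a)) 0 0 - t ^+ 2 / 2 * sqnorm (M *m h).
Proof.
rewrite !objectiveE mulmxDr -scalemxAr sqnormD.
have -> : ((M *m h)^T *m (M *m a)) 0 0 = (h^T *m (Q *m a)) 0 0.
  by rewrite signed_gramE (trmx_mul M h) !mulmxA.
by rewrite mulmxBr linearD linearZ/= mulmxDl -scalemxAl !mxE; field.
Qed.

(** Move from [a] along the gradient [one - Q *m a]: a short step stays feasible, and
it would increase the objective unless the gradient is zero. *)
Lemma stationary_of_interior a : svm_dual_optimal x y a ->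
  (forall i, 0 < a i 0) -> Q *m a = one.
Proof.
move=> [_ opt] a0; apply/eqP; rewrite eq_sym -subr_eq0; apply/eqP.
set g := one - Q *m a; pose S := sqnorm (M *m g).
have S0 : 0 <= S by exact: sqnorm_ge0.
have [e e0 ea] : exists2 e, 0 < e & forall t, 0 < t -> t <= e ->
    svm_dual_feasible (a + t *: g).
  (* A step so short that no coordinate loses more than it has. *)
  pose e := \big[Num.min/1]_i (a i 0 / (1 + `|g i 0|)).
  have g1 i : 0 < 1 + `|g i 0| by rewrite ltr_pwDl.
  exists e.
    by rewrite /e; apply: (big_ind (fun z => 0 < z)) => // [u w u0 w0|i _];
      [rewrite lt_min u0|exact: divr_gt0].
  move=> t t0 te i; rewrite mxE [(t *: g) _ _]mxE.
  have := le_trans te (bigmin_le 1 i (fun i => a i 0 / (1 + `|g i 0|))).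
  rewrite ler_pdivlMr// => h.
  have := lerNnormlW (lexx `|g i 0|); have := normr_ge0 (g i 0).
  nra.
have G t : 0 < t -> t <= e -> t * sqnorm g - t ^+ 2 / 2 * S <= 0.
  move=> t0 te; have := opt _ (ea t t0 te); rewrite objectiveD -/g sqnormE -/S.
  lra.
apply: sqnorm_eq0; apply/eqP; rewrite eq_le sqnorm_ge0 andbT leNgt.
apply/negP => g0.
pose t := Num.min e (sqnorm g / (1 + S)).
have S1 : 0 < 1 + S by rewrite ltr_pwDl.
have t0 : 0 < t by rewrite lt_min e0 divr_gt0.
have te : t <= e by rewrite ge_min lexx.
have : t <= sqnorm g / (1 + S) by rewrite ge_min lexx orbT.
rewrite ler_pdivlMr// => tS; have := G t t0 te; nra.
Qed.

(** Concavity: the objective is a quadratic with no linear term around [a]. *)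
Lemma optimal_of_stationary a : svm_dual_feasible a -> Q *m a = one ->
  svm_dual_optimal x y a.
Proof.
move=> fa Qa; split=> // b _.
rewrite -[b](addrNK a) addrC -[b - a]scale1r objectiveD Qa subrr mulmx0 mxE.
by have := sqnorm_ge0 (M *m (b - a)); lra.
Qed.

(** A kernel vector [k] of [Q] leaves [Q *m a] unchanged.  Take [k] with a negative
coordinate and the longest feasible step: the result is still feasible and
stationary, hence optimal, but it has a zero coordinate. *)
Lemma nonsingular_of_all_support_vectors :
  all_support_vectors x y -> \det Q != 0.
Proof.
move=> [[a opt] pos]; have a0 := pos a opt.
have Qa := stationary_of_interior opt a0.
apply/eqP => /det_eq0_ker[k k0 Qk].
wlog [i ki] : k k0 Qk / exists i, k i 0 < 0.
  move=> wl; have [i ki] : exists i, k i 0 != 0.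
    apply/existsP; apply: contraNT k0; rewrite negb_exists => /forallP k0.
    apply/eqP/matrixP => i j; rewrite ord1 mxE; apply/eqP.
    by have := k0 i; rewrite negbK.
  have [kp|kn] := ltP (k i 0) 0; first by apply: (wl k) => //; exists i.
  apply: (wl (- k)); rewrite ?oppr_eq0 ?mulmxN ?Qk ?oppr0//.
  by exists i; rewrite mxE oppr_lt0 lt_def ki.
pose t := \big[Num.min/(a i 0 / - k i 0)]_(j | k j 0 < 0) (a j 0 / - k j 0).
(* [f j] is the step at which coordinate [j] vanishes. *)
pose f j := a j 0 / - k j 0.
pose m := [arg min_(j < i | k j 0 < 0) f j]%O.
have [km fm] : k m 0 < 0 /\ forall j, k j 0 < 0 -> f m <= f j.
  by rewrite /m; case: arg_minP => // j kj fj; split.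
have fm0 : 0 < f m by rewrite /f divr_gt0// oppr_gt0.
have opt' : svm_dual_optimal x y (a + f m *: k).
  apply: optimal_of_stationary.
    move=> j; rewrite !mxE.
    have [kj|kj] := ltP (k j 0) 0; last by rewrite addr_ge0 ?(ltW (a0 j))// mulr_ge0// ltW.
    have := fm _ kj; rewrite {2}/f ler_pdivlMr ?oppr_gt0//; lra.
  by rewrite mulmxDr -scalemxAr Qk scaler0 addr0.
have := pos _ opt' m; rewrite !mxE /f invrN mulrN mulNr divfK ?lt_eqF//.
by rewrite subrr ltxx.
Qed.

Lemma all_support_vectorsP : all_support_vectors x y <->
  \det Q != 0 /\ forall i, 0 < (\det Q)^-1 * (\adj Q *m one) i 0.
Proof.
split=> [sv|[dQ pos]].
  have dQ := nonsingular_of_all_support_vectors sv; split=> //.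
  move: sv => [[a opt] pos] i; have a0 := pos a opt.
  have Qa := stationary_of_interior opt a0.
  have aE : a = (\det Q)^-1 *: (\adj Q *m one).
    by rewrite -Qa mulmxA mul_adj_mx mul_scalar_mx scalerA mulVf// scale1r.
  by have := a0 i; rewrite {1}aE mxE.
pose a := (\det Q)^-1 *: (\adj Q *m one).
have Qa : Q *m a = one by exact: mulmx_adj_inv.
have a0 i : 0 < a i 0 by rewrite mxE.
have opta : svm_dual_optimal x y a.
  by apply: optimal_of_stationary => // i; exact: ltW.
split; first by exists a.
move=> b [fb optb] i; suff -> : b = a by exact: a0.
have := optb a opta.1.
rewrite -[b in leRHS](addrNK a) addrC -[b - a]scale1r objectiveD Qa subrr mulmx0 mxE.
have := sqnorm_ge0 (M *m (b - a)) => M0 h.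
have /sqnorm_eq0 Mh : sqnorm (M *m (b - a)) = 0 by lra.
apply/eqP; rewrite -subr_eq0; apply/eqP.
have : \det Q *: (b - a) = 0.
  rewrite -mul_scalar_mx -mul_adj_mx -mulmxA [X in _ *m X](_ : _ = 0) ?mulmx0//.
  by rewrite signed_gramE -mulmxA Mh mulmx0.
by move/eqP; rewrite scaler_eq0 (negbTE dQ) => /eqP.
Qed.

End Dual.

Section LeaveOneOut.
Context (R : realType).
Variables (n d : nat) (x : 'I_n -> 'cV[R]_d).

(** The Gram matrix of the other examples, kept at size [n] by putting the identity
in row and column [i]. *)
Definition loo_gram (i : 'I_n) : 'M[R]_n :=
  \matrix_(j, l) if (j == i) || (l == i) then (j == l)%:R else gram x j l.

(** The solution of the interpolation problem, given by Cramer's rule so that it is a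
measurable function of the features without any invertibility assumption.  Entry
[i] of the right-hand side is 0, which forces coefficient [i] to be 0. *)
Definition loo_coef (i : 'I_n) (s : 'I_n -> R) : 'cV[R]_n :=
  (\det (loo_gram i))^-1 *:
    (\adj (loo_gram i) *m \col_j (if j == i then 0 else s j)).

(** The combination of the features [x j], [j != i], that takes the values [s j] on
them, when there is one. *)
Definition loo_interpolator (i : 'I_n) (s : 'I_n -> R) : 'cV[R]_d :=
  \sum_(j < n) loo_coef i s j 0 *: x j.

Lemma loo_gram_row i (k : 'cV[R]_n) : (loo_gram i *m k) i 0 = k i 0.
Proof.
rewrite mxE (bigD1 i)//= big1 => [|l /negbTE li]; last first.
  by rewrite mxE eqxx/= eq_sym li mul0r.
by rewrite mxE !eqxx/= mul1r addr0.
Qed.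

Lemma loo_coef_self i s : loo_coef i s i 0 = 0.
Proof.
have [d0|dn0] := eqVneq (\det (loo_gram i)) 0.
  by rewrite /loo_coef d0 invr0 scale0r mxE.
by rewrite -loo_gram_row mulmx_adj_inv// mxE eqxx.
Qed.

Lemma loo_interpolatorE i s :
  loo_interpolator i s = \sum_(j < n | j != i) loo_coef i s j 0 *: x j.
Proof.
by rewrite /loo_interpolator (bigD1 i)//= loo_coef_self scale0r add0r.
Qed.

Lemma eq_loo_interpolator i s s' : (forall j, j != i -> s j = s' j) ->
  loo_interpolator i s = loo_interpolator i s'.
Proof.
move=> ss'; apply: eq_bigr => j _; congr (_ *: _).
rewrite /loo_coef; congr ((_ *: (_ *m _)) _ _).
by apply/matrixP => k l; rewrite !mxE; case: eqVneq => // /ss'.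
Qed.

Variable m : R.
Hypothesis m0 : 0 < m.
Hypothesis coercive : forall u : 'cV[R]_n, m * sqnorm u <= sqnorm (design x *m u).

Lemma design_mul (u : 'cV[R]_n) : design x *m u = \sum_(j < n) u j 0 *: x j.
Proof.
apply/matrixP => k l; rewrite ord1 mxE summxE; apply: eq_bigr => j _.
by rewrite !mxE mulrC.
Qed.

Lemma gram_quad (u : 'cV[R]_n) :
  \sum_j u j 0 * (gram x *m u) j 0 = sqnorm (design x *m u).
Proof.
rewrite -sqnormE trmx_mul gramE -!mulmxA [RHS]mxE.
by apply: eq_bigr => j _; rewrite [u^T _ _]mxE.
Qed.

Lemma coercive_inj (u : 'cV[R]_n) : sqnorm (design x *m u) = 0 -> u = 0.
Proof.
move=> Xu; apply: sqnorm_eq0; apply/eqP; rewrite eq_le sqnorm_ge0 andbT.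
by have := coercive u; rewrite Xu pmulr_rle0.
Qed.

Lemma loo_gram_rows i j (k : 'cV[R]_n) : j != i -> k i 0 = 0 ->
  (loo_gram i *m k) j 0 = (gram x *m k) j 0.
Proof.
move=> ji ki; rewrite !mxE; apply: eq_bigr => l _; rewrite [loo_gram _ _ _]mxE.
rewrite (negbTE ji)/=; case: eqVneq => [->|//].
by rewrite ki !mulr0.
Qed.

Lemma det_loo_gram i : \det (loo_gram i) != 0.
Proof.
apply: det_neq0_ker => k Kk; have ki : k i 0 = 0.
  by rewrite -loo_gram_row Kk mxE.
apply: coercive_inj; rewrite -gram_quad big1// => j _.
have [->|ji] := eqVneq j i; first by rewrite ki mul0r.
by rewrite -(loo_gram_rows ji)// Kk mxE mulr0.
Qed.

Lemma loo_coef_interp i s j : j != i -> (gram x *m loo_coef i s) j 0 = s j.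
Proof.
move=> ji; rewrite -(loo_gram_rows ji) ?loo_coef_self//.
by rewrite mulmx_adj_inv ?det_loo_gram// mxE (negbTE ji).
Qed.

(** With [S] the squared norm of the interpolator and [u] its coefficients, [S] equals
[\sum_j u_j s_j], and [m |u|^2 <= S] by coercivity.  The inequality
[2 u_j s_j <= m u_j ^ 2 + 1 / m] then gives [2 S <= S + n / m]. *)
Lemma sqnorm_loo_interpolator i s : (forall j, s j ^+ 2 = 1) ->
  sqnorm (loo_interpolator i s) <= n%:R / m.
Proof.
move=> s1; rewrite -[loo_interpolator i s]design_mul; set u := loo_coef i s.
have e : sqnorm (design x *m u) = \sum_j u j 0 * s j.
  rewrite -gram_quad; apply: eq_bigr => j _.
  have [->|ji] := eqVneq j i; first by rewrite loo_coef_self !mul0r.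
  by rewrite loo_coef_interp.
have : 2 * sqnorm (design x *m u) <= m * sqnorm u + n%:R / m.
  have -> : n%:R = \sum_(j < n) (1 : R) by rewrite sumr_const card_ord.
  rewrite e /sqnorm !mulr_sumr mulr_suml.
  rewrite -big_split/=; apply: ler_sum => j _.
  rewrite -subr_ge0.
  have -> : m * u j 0 ^+ 2 + 1 / m - 2 * (u j 0 * s j) = (m * u j 0 - s j) ^+ 2 / m.
    by rewrite sqrrB s1; field; rewrite gt_eqF.
  by rewrite divr_ge0 ?sqr_ge0// ltW.
have := coercive u; lra.
Qed.

(** Let [b] be the signed dual solution and [u] the leave-one-out coefficients.  The
interpolators differ by a vector orthogonal to all [x j] with [j != i], so the
squared norm of the difference is [b_i (y_i - r)] where [r] is the leave-one-out
prediction at [x i].  It is positive because [|r| < 1], and [y_i - r] has the sign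
of [y_i], so [y_i b_i > 0]. *)
Lemma all_support_vectors_of_loo (y : 'rV[R]_n) :
  (forall i, y 0 i ^+ 2 = 1) ->
  (forall i, `|((x i)^T *m loo_interpolator i (fun j => y 0 j)) 0 0| < 1) ->
  all_support_vectors x y.
Proof.
move=> y1 loo; apply/all_support_vectorsP.
have dQ : \det (signed_gram x y) != 0.
  apply: det_neq0_ker => k Qk.
  have Mk : design x *m (diag_mx y *m k) = 0.
    apply: sqnorm_eq0; rewrite mulmxA -signed_gram_quad -mulmxA Qk mulmx0 mxE//.
  have yk : diag_mx y *m k = 0.
    by apply: coercive_inj; rewrite Mk /sqnorm big1// => i _; rewrite mxE expr0n.
  apply/matrixP => i j; rewrite ord1 mxE.
  have := congr1 (fun A : 'cV[R]_n => A i 0) yk; rewrite mul_diag_mx !mxE => yki.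
  by rewrite -[k i 0]mul1r -(y1 i) expr2 -mulrA yki mulr0.
split=> // i.
pose a : 'cV[R]_n := (\det (signed_gram x y))^-1 *: (\adj (signed_gram x y) *m const_mx 1).
pose b := diag_mx y *m a.
have Qa : signed_gram x y *m a = const_mx 1 by exact: mulmx_adj_inv.
suff : 0 < y 0 i * b i 0.
  by rewrite /b mul_diag_mx mxE mulrA -expr2 y1 mul1r /a mxE.
have Kb j : (gram x *m b) j 0 = y 0 j.
  have := congr1 (fun A : 'cV[R]_n => A j 0) Qa.
  rewrite /signed_gram tr_diag_mx -!mulmxA mul_diag_mx mxE [RHS]mxE -/b => h.
  by rewrite -[LHS]mul1r -(y1 j) expr2 -mulrA h mulr1.
set u := loo_coef i (fun j => y 0 j).
set r := ((x i)^T *m loo_interpolator i (fun j => y 0 j)) 0 0.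
have Ku : (gram x *m u) i 0 = r.
  rewrite /r -[loo_interpolator _ _]design_mul gramE -mulmxA !mxE.
  by apply: eq_bigr => k _; rewrite !mxE.
have Kbu j : (gram x *m (b - u)) j 0 = y 0 j - (gram x *m u) j 0.
  by rewrite mulmxBr [LHS]mxE Kb; congr (_ + _); rewrite [LHS]mxE.
have bu0 : (b - u) i 0 = b i 0.
  by rewrite mxE [(- u) _ _]mxE loo_coef_self subr0.
have e : sqnorm (design x *m (b - u)) = b i 0 * (y 0 i - r).
  rewrite -gram_quad (bigD1 i)//= big1 => [|j ji].
    by rewrite addr0 Kbu bu0 Ku.
  by rewrite Kbu loo_coef_interp// subrr mulr0.
have := loo i; rewrite -/r => r1.
have yr : 0 < y 0 i * (y 0 i - r).
  rewrite mulrBr -expr2 y1 subr_gt0; apply: le_lt_trans r1.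
  apply: le_trans (ler_norm _) _; rewrite normrM.
  have /eqP := y1 i; rewrite sqrf_eq1 => /orP[]/eqP->; rewrite ?normrN normr1 mul1r//.
have b0 : 0 < b i 0 * (y 0 i - r).
  rewrite -e lt_def sqnorm_ge0 andbT; apply/eqP => /coercive_inj bu.
  move: e; rewrite bu mulmx0 /sqnorm big1 => [|k _]; last by rewrite mxE expr0n.
  move=> /esym/eqP; rewrite mulf_eq0 => /orP[/eqP bi|/eqP yr0]; last first.
    by move: yr; rewrite yr0 mulr0 ltxx.
  have : (gram x *m (b - u)) i 0 = 0 by rewrite bu mulmx0 mxE.
  rewrite Kbu Ku => yr0.
  by move: yr; rewrite yr0 mulr0 ltxx.
have := mulr_gt0 b0 yr; rewrite [X in 0 < X](_ : _ =
  (y 0 i * b i 0) * (y 0 i - r) ^+ 2); last by ring.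
by rewrite pmulr_lgt0// lt_def sqr_ge0 andbT sqrf_eq0; apply/eqP => h;
  move: yr; rewrite h mulr0 ltxx.
Qed.

End LeaveOneOut.

(** * Versions of conditional probabilities *)

Section DensityMeasure.
Context (R : realType) (disp : measure_display) (T : measurableType disp).
Variable P : {measure set T -> \bar R}.
Variable f : T -> \bar R.
Hypothesis mf : measurable_fun setT f.
Hypothesis f0 : forall w, (0 <= f w)%E.

Definition density (A : set T) : \bar R := (\int[P]_(w in A) f w)%E.

Let density0 : density set0 = 0%E.
Proof. exact: integral_set0. Qed.

Let density_ge0 A : (0 <= density A)%E.
Proof. exact: integral_ge0. Qed.

Let density_sigma_additive : semi_sigma_additive density.
Proof.
move=> F mF tF mUF; rewrite /density ge0_integral_bigcup//; last first.
  exact: measurable_funTS.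
by apply: is_cvg_nneseries => n _ _; exact: integral_ge0.
Qed.

HB.instance Definition _ := isMeasure.Build _ _ _ density
  density0 density_ge0 density_sigma_additive.

Definition density_measure : {measure set T -> \bar R} := density.

End DensityMeasure.

Section CondProbVersion.
Context (R : realType) (disp : measure_display) (T : measurableType disp).
Variable P : probability T R.

Lemma integral_indicE (B : set T) (f : T -> R) :
  (\int[P]_(w in B) (f w)%:E = \int[P]_w ((f w)%:E * (\1_B w)%:E))%E.
Proof. by rewrite integral_mkcond epatch_indic. Qed.

(** Both sides are finite measures of [B], so a pi-system decides. *)
Lemma integral_prob_gen (G : set (set T)) (A : set T) (f : T -> R) :
  setI_closed G -> G setT -> G `<=` measurable -> measurable A ->
  measurable_fun setT f -> (forall w, 0 <= f w) ->
  (forall B, G B -> (\int[P]_(w in B) (f w)%:E = P (A `&` B))%E) ->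
  forall B, <<s G >> B -> (\int[P]_(w in B) (f w)%:E = P (A `&` B))%E.
Proof.
move=> GI GT Gm mA mf f0 GE B sB.
have mEf : measurable_fun setT (EFin \o f) by exact/measurable_EFinP.
have f0' w : (0 <= (EFin \o f) w)%E by rewrite lee_fin.
pose m1 := density_measure P mEf f0'.
rewrite setIC -[RHS]/(mrestr P mA B) -[LHS]/(m1 B).
apply: (@g_sigma_algebra_measure_unique _ R T G Gm (fun=> setT)) sB => //.
- by rewrite bigcup_const//; exists 0%N.
- by move=> C GC; rewrite -[RHS]/(P (C `&` A)) [C `&` A]setIC; exact: GE.
- move=> _; rewrite [X in (X < _)%E]GE//.
  by rewrite setIT (le_lt_trans (probability_le1 P mA))// ltry.
Qed.

Section Version.
Variable F : set (T -> R).
Hypothesis mF : sigma_of F `<=` measurable.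

Lemma cond_prob_version_measurable A q : cond_prob_version P (sigma_of F) A q ->
  measurable_fun [set: salg F] (q : salg F -> R).
Proof. by move=> [mq _ _] _ B mB; rewrite setTI; exact: mq. Qed.

(** Equality of all integrals over a sub-sigma-algebra is turned into equality almost
everywhere on the space that carries only that sub-sigma-algebra. *)
Lemma cond_prob_version_ae_eq A q q' :
  cond_prob_version P (sigma_of F) A q -> cond_prob_version P (sigma_of F) A q' ->
  ae_eq P setT (EFin \o q) (EFin \o q').
Proof.
move=> vq vq'; have mq := cond_prob_version_measurable vq.
have mq' := cond_prob_version_measurable vq'.
have mid : measurable_fun [set: T] (fun w : T => w : salg F).
  by move=> _ A' mA'; rewrite setTI; exact: mF.
pose X : {mfun T >-> salg F} := HB.pack (fun w : T => w : salg F)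
  (isMeasurableFun.Build _ _ _ _ _ mid).
pose mu := distribution P X.
have iE (g : T -> R) (E : set T) : measurable_fun [set: salg F] (g : salg F -> R) ->
    P.-integrable setT (EFin \o g) -> sigma_of F E ->
    (\int[mu]_(w in E) (g w)%:E = \int[P]_(w in E) (g w)%:E)%E.
  move=> mg ig mE; rewrite integral_pushforward//; first exact/measurable_EFinP.
  by apply: integrableS ig => //; exact: mF.
have [_ iq Eq] := vq; have [_ iq' Eq'] := vq'.
have : ae_eq mu setT (EFin \o q : salg F -> _) (EFin \o q' : salg F -> _).
  apply: integral_ae_eq => //.
  - apply/integrableP; split; first exact/measurable_EFinP.
    rewrite ge0_integral_pushforward//; last first.
      by apply: measurableT_comp => //; exact/measurable_EFinP.
    by have /integrableP[] := iq.
  - exact/measurable_EFinP.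
  - by move=> E _ mE; rewrite [LHS]iE// [RHS]iE// Eq// Eq'.
move=> [N [mN N0 Nsub]]; exists N; split => //; exact: mF.
Qed.

(** On the event where [q] is negative the integral of [q] is a probability, so it
vanishes; truncating [q] there changes no integral. *)
Lemma cond_prob_version_max0 A q : measurable A ->
  cond_prob_version P (sigma_of F) A q ->
  cond_prob_version P (sigma_of F) A (fun w => Num.max (q w) 0).
Proof.
move=> mA vq; have mq := cond_prob_version_measurable vq.
have [qF iq Eq] := vq.
have mmax : measurable_fun [set: salg F] ((fun w => Num.max (q w) 0) : salg F -> R).
  exact: measurable_maxr.
split.
- by move=> B mB; rewrite -[X in sigma_of _ X]setTI; exact: mmax.
- apply: le_integrable iq => //.
    by apply/measurable_EFinP; exact: measurable_fun_salg_ambient mmax.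
  move=> w _; rewrite lee_fin ger0_norm ?le_max ?lexx ?orbT//.
  by rewrite ge_max ler_norm normr_ge0.
- move=> B sB; pose N := q @^-1` `]-oo, 0[%classic.
  have sN : sigma_of F N by apply: qF; exact: measurable_itv.
  have sBN : sigma_of F (B `&` N) by exact: (@measurableI _ (salg F)).
  have sBD : sigma_of F (B `\` N) by exact: (@measurableD _ (salg F)).
  have PBN : P (A `&` (B `&` N)) = 0%E.
    apply/eqP; rewrite eq_le measure_ge0 andbT -Eq//.
    rewrite -(integral0 P (B `&` N)); apply: le_integral.
    - exact: mF.
    - by apply: integrableS iq => //; exact: mF.
    - exact: integrable0.
    - by move=> w; rewrite inE => -[_]; rewrite /N/= in_itv/= lee_fin => /ltW.
  have -> : P (A `&` B) = P (A `&` (B `\` N)).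
    have mB := mF sB; have mN := mF sN.
    rewrite (measureDI P (measurableI _ _ mA mB) mN) -setIDA -setIA.
    by rewrite [X in (_ + X)%E](_ : _ = 0%E) ?adde0// -PBN.
  rewrite -Eq//.
  rewrite [LHS]integral_indicE [RHS]integral_indicE; apply: eq_integral => w _.
  rewrite -!EFinM !indicE in_setD.
  have [q0|q0] := ltP (q w) 0.
    by rewrite (mem_set (_ : N w)) ?andbF ?mulr0 ?mul0r// /N/= in_itv.
  rewrite (memNset (_ : ~ N w)) ?andbT// /N/= in_itv/=.
  by rewrite ltNge q0.
Qed.

End Version.
End CondProbVersion.

(** * Conditional law of the labels *)

Section Labels.
Context (R : realType) (disp : measure_display) (T : measurableType disp).
Variable P : probability T R.
Variables (n d : nat) (v : R) (lam : 'rV[R]_d).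
Variables (Z : 'I_n -> 'I_d -> {RV P >-> R}) (y : 'I_n -> {RV P >-> R}).
Hypothesis HZ : independent_entries v Z.
Hypothesis Hy : label_model (feature lam Z) y.

Notation x := (feature lam Z).
Let X (k : 'I_n * 'I_d) : T -> R := Z k.1 k.2.

Lemma featureE w i j : x w i j 0 = Num.sqrt (lam 0 j) * Z i j w.
Proof. by rewrite /feature mul_diag_mx !mxE. Qed.

(** The generating families of the sigma-algebras of one example's features, of all
features, and of the features of the other examples. *)
Definition feature_gen (i : 'I_n) : set (T -> R) :=
  [set f | exists j, f = fun w => x w i j 0].
Definition features_gen : set (T -> R) :=
  [set f | exists i j, f = fun w => x w i j 0].
Definition other_features_gen (i : 'I_n) : set (T -> R) :=
  [set f | exists k, k != i /\ exists j, f = fun w => x w k j 0].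

Lemma measurable_feature i j : measurable_fun setT (fun w => x w i j 0).
Proof.
under eq_fun do rewrite featureE.
by apply: measurable_funM => //; exact: measurable_funP.
Qed.

Lemma feature_gen_measurable i : sigma_of (feature_gen i) `<=` measurable.
Proof. by apply: sigma_of_measurable => _ [j ->]; exact: measurable_feature. Qed.

Lemma features_gen_measurable : sigma_of features_gen `<=` measurable.
Proof. by apply: sigma_of_measurable => _ [i [j ->]]; exact: measurable_feature. Qed.

Lemma other_features_gen_measurable i :
  sigma_of (other_features_gen i) `<=` measurable.
Proof.
by apply: sigma_of_measurable => _ [k [_ [j ->]]]; exact: measurable_feature.
Qed.

Lemma feature_genS i : sigma_of (feature_gen i) `<=` sigma_of features_gen.
Proof. by apply: sigma_of_le => _ [j ->]; apply: sigma_of_gen; exists i, j. Qed.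

Lemma other_features_genS i :
  sigma_of (other_features_gen i) `<=` sigma_of features_gen.
Proof. by apply: sigma_of_le => _ [k [_ [j ->]]]; apply: sigma_of_gen; exists k, j. Qed.

Lemma feature_gen_otherS i k : k != i ->
  sigma_of (feature_gen k) `<=` sigma_of (other_features_gen i).
Proof.
move=> ki; apply: sigma_of_le => _ [j ->]; apply: sigma_of_gen.
by exists k; split => //; exists j.
Qed.

Lemma feature_fam i :
  sigma_of (feature_gen i) `<=` sigma_fam X [set k | k.1 == i]%SET.
Proof.
apply: sigma_of_le => _ [j ->].
rewrite (_ : (fun w => _) = fun w => Num.sqrt (lam 0 j) * X (i, j) w).
  apply: measurable_funM => //; apply: sigma_of_gen.
  by exists (i, j) => //; rewrite inE.
by apply/funext => w; rewrite featureE.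
Qed.

Lemma other_features_fam i :
  sigma_of (other_features_gen i) `<=` sigma_fam X [set k | k.1 != i]%SET.
Proof.
apply: sigma_of_le => _ [k [ki [j ->]]].
rewrite (_ : (fun w => _) = fun w => Num.sqrt (lam 0 j) * X (k, j) w).
  apply: measurable_funM => //; apply: sigma_of_gen.
  by exists (k, j) => //; rewrite inE.
by apply/funext => w; rewrite featureE.
Qed.

Lemma row_indep i :
  indep_classes P (sigma_fam X [set k | k.1 == i]%SET)
                  (sigma_fam X [set k | k.1 != i]%SET).
Proof.
have [Zind _] := HZ; apply: sigma_fam_indep => //.
rewrite disjoint_subset; apply/fintype.subsetP => k; rewrite !inE.
by move=> ->.
Qed.

Lemma feature_indep i :
  indep_classes P (sigma_of (feature_gen i)) (sigma_of (other_features_gen i)).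
Proof.
move=> A B sA sB; apply: (row_indep (i := i)).
  exact: feature_fam.
exact: other_features_fam.
Qed.

Lemma label_measurable i A : sigma_label (fun k => y k) i A -> measurable A.
Proof. by move: A; apply: sigma_of_measurable => _ ->; exact: measurable_funP. Qed.

(** Given the features of example [i], its label is independent of the features of
the others, and the conditional probability of [B2] is the constant [P B2]. *)
Lemma label_indep i A B1 B2 : sigma_label (fun k => y k) i A ->
  sigma_of (feature_gen i) B1 -> sigma_of (other_features_gen i) B2 ->
  (P (A `&` (B1 `&` B2)) = P (A `&` B1) * P B2)%E.
Proof.
move=> sA sB1 sB2; have [_ _ /(_ i)] := Hy.
have mB2 := other_features_gen_measurable sB2.
have mB1 := feature_gen_measurable sB1.
have sB2' : sigma_other_examples x (fun k => y k) i B2.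
  move: sB2; apply: sigma_of_le => _ [k [ki [j ->]]]; apply: sigma_of_gen.
  by exists k; split => //; right; exists j.
move=> /(_ (fun b => if b then A else B2)) [|q [vq vprod]]; first by case.
have vt := vq true; have vf := vq false; rewrite /= in vt vf.
have cB2 : cond_prob_version P (sigma_of (feature_gen i)) B2 (fun=> fine (P B2)).
  split.
  - move=> B mB; rewrite preimage_cst; case: ifP => _.
      exact: (@measurableT _ (salg (feature_gen i))).
    exact: (@measurable0 _ (salg (feature_gen i))).
  - exact: finite_measure_integrable_cst.
  - move=> B sB; have mB := feature_gen_measurable sB.
    rewrite integral_cst// fineK ?fin_num_measure// setIC muleC.
    by rewrite (feature_indep sB sB2).
have qf : ae_eq P setT (EFin \o q false) (EFin \o fun=> fine (P B2)).
  by apply: cond_prob_version_ae_eq vf cB2; exact: feature_gen_measurable.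
have [_ _ /(_ B1 sB1)] := vprod [set: bool]%SET.
rewrite (_ : \bigcap_(b in _) _ = A `&` B2); last first.
  apply/seteqP; split=> [w wb|w [wA wB] [] _] //.
  by split; [apply: (wb true)|apply: (wb false)]; rewrite /= inE.
rewrite setIA [in X in _ -> X]setIAC => <-.
have mqt : measurable_fun setT (q true).
  apply: measurable_fun_salg_ambient (cond_prob_version_measurable vt).
  exact: feature_gen_measurable.
have mqf : measurable_fun setT (q false).
  apply: measurable_fun_salg_ambient (cond_prob_version_measurable vf).
  exact: feature_gen_measurable.
have prodE w : \prod_(b in [set: bool]%SET) q b w = q true w * q false w.
  by rewrite (eq_bigl xpredT) ?big_bool// => b; rewrite inE.
under eq_integral do rewrite prodE EFinM.
transitivity (\int[P]_(w in B1) ((q true w)%:E * (fine (P B2))%:E))%E.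
  apply: ae_eq_integral => //.
  - apply: measurable_funTS; apply: emeasurable_funM; exact/measurable_EFinP.
  - apply: measurable_funTS; apply: emeasurable_funM => //.
    exact/measurable_EFinP.
  - case: qf => N [mN N0 Nsub]; exists N; split => // w Hw; apply: Nsub => /= qfw.
    apply: Hw => B1w; have := qfw Logic.I; rewrite /= => -[qE].
    by rewrite qE.
have [_ iqt Eqt] := vt.
rewrite integralZr//; last by apply: integrableS iqt.
by rewrite Eqt// fineK ?fin_num_measure.
Qed.


(** By [label_indep] the conditional probability of a label event given its own
features is also the one given all features: the rectangles [B1 `&` B2] form a
generating pi-system. *)
Lemma label_version_features i A r : sigma_label (fun k => y k) i A ->
  (forall w, 0 <= r w) ->
  cond_prob_version P (sigma_of (feature_gen i)) A r ->
  cond_prob_version P (sigma_of features_gen) A r.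
Proof.
move=> sA r0 vr; have mr := cond_prob_version_measurable vr.
have [rF ir Er] := vr; split => //.
  by move=> B mB; apply: (feature_genS (i := i)); exact: rF.
pose G := [set C | exists B1 B2, [/\ sigma_of (feature_gen i) B1,
  sigma_of (other_features_gen i) B2 & C = B1 `&` B2]].
have s1T : sigma_of (feature_gen i) setT by exact: (@measurableT _ (salg _)).
have s2T : sigma_of (other_features_gen i) setT by exact: (@measurableT _ (salg _)).
have mrT : measurable_fun setT r.
  by apply: measurable_fun_salg_ambient mr; exact: feature_gen_measurable.
have GI : setI_closed G.
  move=> _ _ [B1 [B2 [s1 s2 ->]]] [C1 [C2 [t1 t2 ->]]].
  exists (B1 `&` C1), (B2 `&` C2); split; last by rewrite setIACA.
    exact: (@measurableI _ (salg (feature_gen i))).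
  exact: (@measurableI _ (salg (other_features_gen i))).
have GE B : G B -> (\int[P]_(w in B) (r w)%:E = P (A `&` B))%E.
  move=> [B1 [B2 [s1 s2 ->]]]; rewrite (label_indep sA s1 s2) -Er//.
  have mB2 := other_features_gen_measurable s2.
  rewrite -[in P B2](setIT B2) -integral_indic//.
  rewrite (integral_indicE P (B1 `&` B2) r) (integral_indicE P B1 r).
  rewrite -(indep_expectationM (F1 := feature_gen i) (F2 := other_features_gen i)).
  - by apply: eq_integral => w _; rewrite indicI -!EFinM mulrA.
  - exact: feature_gen_measurable.
  - exact: other_features_gen_measurable.
  - exact: feature_indep.
  - apply/measurable_EFinP; apply: measurable_funM => //.
  - apply/measurable_EFinP.
    exact: (@measurable_indic _ (salg (other_features_gen i)) R setT B2 s2).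
  - by move=> w; rewrite -EFinM lee_fin mulr_ge0.
  - by move=> w; rewrite lee_fin.
move=> B sB; apply: (integral_prob_gen GI _ _ _ _ _ GE) => //.
- by exists setT, setT; rewrite setIT.
- move=> _ [B1 [B2 [s1 s2 ->]]]; apply: measurableI.
    exact: feature_gen_measurable s1.
  exact: other_features_gen_measurable s2.
- exact: label_measurable sA.
- move: B sB; apply: sigma_of_subset; first exact: smallest_sigma_algebra.
  move=> _ [k [j ->]] B mB; apply: sub_sigma_algebra.
  have [->|ki] := eqVneq k i.
    exists ((fun w => x w i j 0) @^-1` B), setT; split=> //; last by rewrite setIT.
    rewrite -[X in sigma_of _ X]setTI.
    by apply: (sigma_of_gen (F := feature_gen i)) => //; exists j.
  exists setT, ((fun w => x w k j 0) @^-1` B); split=> //; last by rewrite setTI.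
  rewrite -[X in sigma_of _ X]setTI.
  apply: (sigma_of_gen (F := other_features_gen i)) => //.
  by exists k; split => //; exists j.
Qed.

(** Given all features the labels are conditionally independent, and each factor can
be taken as a function of the features of its own example; the product over
[j != i] then ignores the features of example [i]. *)
Lemma labels_density i (A : 'I_n -> set T) :
  (forall j, sigma_label (fun k => y k) j (A j)) ->
  exists Q : T -> R,
    [/\ forall w, 0 <= Q w,
        measurable_fun [set: salg (other_features_gen i)]
          (Q : salg (other_features_gen i) -> R) &
        forall B, sigma_of features_gen B ->
          (P (\bigcap_(j in [set` [set j | j != i]%SET]) A j `&` B)
           = \int[P]_(w in B) (Q w)%:E)%E].
Proof.
move=> sA; have [_ call cone] := Hy.
have [q [vq vprod]] := call A sA.
have /choice[r r_] : forall j, exists r : T -> R, (forall w, 0 <= r w) /\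
    cond_prob_version P (sigma_of (feature_gen j)) (A j) r.
  move=> j; have mA := label_measurable (sA j).
  have [|p [/(_ true) vp _]] := cone j (fun b => if b then A j else setT).
    by case=> //; exact: (@measurableT _ (salg _)).
  exists (fun w => Num.max (p true w) 0); split.
    by move=> w; rewrite le_max lexx orbT.
  by apply: cond_prob_version_max0 => //; exact: feature_gen_measurable.
have r0 j w : 0 <= r j w by have [] := r_ j.
have vr j : cond_prob_version P (sigma_of (feature_gen j)) (A j) (r j).
  by have [] := r_ j.
have qr j : ae_eq P setT (EFin \o q j) (EFin \o r j).
  apply: cond_prob_version_ae_eq (vq j) _; first exact: features_gen_measurable.
  by apply: label_version_features => //; exact: sA.
have mr j : j != i -> measurable_fun [set: salg (other_features_gen i)]
    (r j : salg (other_features_gen i) -> R).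
  move=> ji; apply: measurable_fun_salgS (cond_prob_version_measurable (vr j)).
  exact: feature_gen_otherS.
pose Q w := \prod_(j in [set j | j != i]%SET) r j w.
have mQ : measurable_fun [set: salg (other_features_gen i)]
    (Q : salg (other_features_gen i) -> R).
  rewrite (_ : Q = fun w => \prod_(j <- enum [set j | j != i]%SET) r j w).
    apply: (@measurable_prod _ (salg _)) => j; rewrite mem_enum inE; exact: mr.
  by apply/funext => w; rewrite /Q big_enum.
have mQT : measurable_fun setT Q.
  by apply: measurable_fun_salg_ambient mQ; exact: other_features_gen_measurable.
exists Q; split=> // [w|B sB]; first by apply: prodr_ge0.
have [qF iq <-//] := vprod [set j | j != i]%SET.
apply: ae_eq_integral.
- exact: features_gen_measurable.
- by apply: measurable_funTS; have /integrableP[] := iq.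
- by apply: measurable_funTS; exact/measurable_EFinP.
have aeall : {ae P, forall w, forall j, setT w -> q j w = r j w}.
  by apply: filter_forall => j; apply: filterS (qr j) => w h wT; have [] := h wT.
apply: filterS aeall => w h Bw /=; congr (_%:E).
by apply: eq_bigr => j _; exact: h.
Qed.

End Labels.

(** * Measurability of matrix expressions *)

Section MeasurableMatrix.
Context (R : realType) (disp : measure_display) (T : measurableType disp).

Lemma measurable_big_sum (I : finType) (p : pred I) (h : I -> T -> R) :
  (forall i, p i -> measurable_fun setT (h i)) ->
  measurable_fun setT (fun w => \sum_(i | p i) h i w).
Proof.
move=> mh.
rewrite (_ : (fun w => _) = fun w => \sum_i (if p i then h i w else 0)).
  by apply: measurable_sum => i; case: (boolP (p i)) => [/mh|_].
by apply/funext => w; rewrite big_mkcond.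
Qed.

Lemma measurable_det (n : nat) (A : T -> 'M[R]_n) :
  (forall i j, measurable_fun setT (fun w => A w i j)) ->
  measurable_fun setT (fun w => \det (A w)).
Proof.
move=> mA; apply: measurable_big_sum => s _; apply: measurable_funM => //.
by apply: measurable_prod => i _; exact: mA.
Qed.

Lemma measurable_mulmx (m n p : nat) (A : T -> 'M[R]_(m, n)) (B : T -> 'M[R]_(n, p)) :
  (forall i j, measurable_fun setT (fun w => A w i j)) ->
  (forall i j, measurable_fun setT (fun w => B w i j)) ->
  forall i j, measurable_fun setT (fun w => (A w *m B w) i j).
Proof.
move=> mA mB i j; under eq_fun do rewrite mxE.
by apply: measurable_sum => k; exact: measurable_funM.
Qed.

Lemma measurable_adj (n : nat) (A : T -> 'M[R]_n) :
  (forall i j, measurable_fun setT (fun w => A w i j)) ->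
  forall i j, measurable_fun setT (fun w => \adj (A w) i j).
Proof.
move=> mA i j; under eq_fun do rewrite mxE /cofactor.
apply: measurable_funM => //; apply: measurable_det => k l.
by under eq_fun do rewrite !mxE; exact: mA.
Qed.

Lemma measurable_invr (f : T -> R) : measurable_fun setT f ->
  measurable_fun setT (fun w => (f w)^-1).
Proof.
(* Also valid at 0, where both sides are 0. *)
move=> mf; rewrite (_ : (fun w => _) = fun w => f w * (f w ^+ 2) `^ (- 1)).
  apply: measurable_funM => //.
  apply: (@measurableT_comp _ _ _ _ _ _ (fun z : R => z `^ (- 1)) _
    (fun w => f w ^+ 2)); first exact: measurable_powR.
  exact: measurable_funX.
apply/funext => w; rewrite powR_inv1 ?sqr_ge0//.
have [->|f0] := eqVneq (f w) 0; first by rewrite invr0 mul0r.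
by field.
Qed.

End MeasurableMatrix.

Section MeasurableInterpolator.
Context (R : realType) (disp : measure_display) (T : measurableType disp).
Variables (n d : nat) (x : T -> 'I_n -> 'cV[R]_d) (i : 'I_n).
Hypothesis mx : forall j k, j != i -> measurable_fun setT (fun w => x w j k 0).

Lemma measurable_loo_gram j l :
  measurable_fun setT (fun w => loo_gram (x w) i j l).
Proof.
under eq_fun do rewrite mxE.
have [_|ji] := eqVneq j i; first exact: measurable_cst.
have [_|li] /= := eqVneq l i; first exact: measurable_cst.
under eq_fun do rewrite gram_entry.
by apply: measurable_sum => k; apply: measurable_funM; exact: mx.
Qed.

Lemma measurable_loo_coef s j :
  measurable_fun setT (fun w => loo_coef (x w) i s j 0).
Proof.
under eq_fun do rewrite mxE; apply: measurable_funM.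
  by apply: measurable_invr; apply: measurable_det; exact: measurable_loo_gram.
apply: measurable_mulmx; first by apply: measurable_adj; exact: measurable_loo_gram.
by move=> a b; exact: measurable_cst.
Qed.

Lemma measurable_loo_interpolator s k :
  measurable_fun setT (fun w => loo_interpolator (x w) i s k 0).
Proof.
under eq_fun do rewrite loo_interpolatorE summxE.
apply: measurable_big_sum => j ji; under eq_fun do rewrite mxE.
by apply: measurable_funM; [exact: measurable_loo_coef|exact: mx].
Qed.

End MeasurableInterpolator.

Section MeasurableEvent.
Context (R : realType) (disp : measure_display) (T : measurableType disp).
Variables (n d : nat) (x : T -> 'I_n -> 'cV[R]_d) (y : T -> 'rV[R]_n).
Hypothesis mx : forall j k, measurable_fun setT (fun w => x w j k 0).
Hypothesis my : forall j, measurable_fun setT (fun w => y w 0 j).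

Lemma measurable_signed_gram j l :
  measurable_fun setT (fun w => signed_gram (x w) (y w) j l).
Proof.
rewrite (_ : (fun w => _) =
  fun w => y w 0 j * (\sum_k x w j k 0 * x w l k 0) * y w 0 l).
  apply: measurable_funM => //; apply: measurable_funM => //.
  by apply: measurable_sum => k; exact: measurable_funM.
apply/funext => w; rewrite /signed_gram tr_diag_mx mul_mx_diag mxE mul_diag_mx mxE.
by rewrite gram_entry.
Qed.

Lemma measurable_all_support_vectors :
  measurable [set w | all_support_vectors (x w) (y w)].
Proof.
pose D w := \det (signed_gram (x w) (y w)).
pose a i w := (D w)^-1 *
  (\adj (signed_gram (x w) (y w)) *m (const_mx 1 : 'cV[R]_n)) i 0.
have mD : measurable_fun setT D by apply: measurable_det; exact: measurable_signed_gram.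
have ma i : measurable_fun setT (a i).
  apply: measurable_funM; first exact: measurable_invr.
  apply: measurable_mulmx; first by apply: measurable_adj; exact: measurable_signed_gram.
  by move=> k l; exact: measurable_cst.
rewrite (_ : [set w | _] = [set w | D w != 0] `&`
    \bigcap_(i in [set: 'I_n]) [set w | 0 < a i w]).
  apply: measurableI.
    rewrite (_ : [set w | _] = ~` (D @^-1` [set 0])).
      by apply: measurableC; rewrite -[X in measurable X]setTI; apply: mD.
    by apply/seteqP; split=> w /=; [move=> /eqP|move=> h; apply/eqP].
  apply: fin_bigcap_measurable => // i _; rewrite -[X in measurable X]setTI.
  by apply: measurable_fun_ltr => //.
apply/seteqP; split=> w /=.
  by move=> /all_support_vectorsP[dQ pos]; split => // i _; exact: pos.
by move=> [dQ pos]; apply/all_support_vectorsP; split => // i; exact: pos.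
Qed.

End MeasurableEvent.

(** * Tail of a feature against a frozen direction *)

Section Hoeffding.
Context (R : realType) (disp : measure_display) (T : measurableType disp).
Variable P : probability T R.
Variables (n d : nat) (v : R) (lam : 'rV[R]_d).
Variables (Z : 'I_n -> 'I_d -> {RV P >-> R}).
Hypothesis v0 : 0 < v.
Hypothesis lam0 : forall j, 0 < lam 0 j.
Hypothesis HZ : independent_entries v Z.
Hypothesis d0 : (0 < d)%N.

Notation x := (feature lam Z).
Let X (k : 'I_n * 'I_d) : T -> R := Z k.1 k.2.
Variable i : 'I_n.
Notation F1 := (feature_gen lam Z i).
Notation F2 := (other_features_gen lam Z i).

(** The weights [lam] enter through [\sum_k lam_k W_k ^ 2], bounded with the largest
of them. *)
Lemma row_mgf (W : 'I_d -> R) :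
  (\int[P]_w (expR (\sum_k x w i k 0 * W k))%:E
   <= (expR (v * linf_norm lam * (\sum_k W k ^+ 2) / 2))%:E)%E.
Proof.
have [Zind Zm] := HZ.
have uE : uniq [seq (i, k) | k <- enum 'I_d].
  by rewrite map_inj_uniq ?enum_uniq// => k k' [].
pose t (k : 'I_n * 'I_d) := Num.sqrt (lam 0 k.2) * W k.2.
under eq_integral => w _.
  rewrite (_ : \sum_k _ = \sum_(k <- [seq (i, k) | k <- enum 'I_d]) t k * X k w).
    over.
  rewrite big_map big_enum/=; apply: eq_bigr => k _.
  by rewrite featureE /t /X /=; ring.
apply: le_trans (mgf_lin_comb (X := X) (v := v) _ Zind _ _ uE) _.
- by move=> k; exact: measurable_funP.
- by move=> k; have [] := Zm k.1 k.2.
rewrite lee_fin ler_expR ler_wpM2r// -mulrA ler_wpM2l ?(ltW v0)//.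
rewrite big_map big_enum/= mulr_sumr; apply: ler_sum => k _.
rewrite /t/= exprMn sqr_sqrtr ?(ltW (lam0 _))// ler_wpM2r ?sqr_ge0//.
exact: le_linf_norm.
Qed.

(** Chernoff's bound with exponent [t = 1 / (v |lam|_inf V)].  Under the density [Q] the
direction [W] depends on the other examples only, so it can be frozen while the
features of example [i] are integrated out. *)
Lemma hoeffding_frozen (W : 'I_d -> T -> R) (Q : T -> R) (V : R) :
  0 < V ->
  (forall k, measurable_fun [set: salg F2] (W k : salg F2 -> R)) ->
  measurable_fun [set: salg F2] (Q : salg F2 -> R) -> (forall w, 0 <= Q w) ->
  (\int[P]_(w in [set w | (\sum_k W k w ^+ 2 <= V)%R
                       /\ (1 <= \sum_k x w i k 0 * W k w)%R]) (Q w)%:E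
   <= (expR (- (2 * v * linf_norm lam * V)^-1))%:E * \int[P]_w (Q w)%:E)%E.
Proof.
move=> V0 mW mQ Q0; set B := [set w | _].
have Li0 : 0 < linf_norm lam by exact: linf_norm_gt0.
set Li := linf_norm lam in Li0 *.
pose t := (v * Li * V)^-1.
have t0 : 0 < t by rewrite invr_gt0 !mulr_gt0.
pose D := [set w | \sum_k W k w ^+ 2 <= V].
have mW2 : measurable_fun [set: salg F2] ((fun w => \sum_k W k w ^+ 2) : salg F2 -> R).
  by apply: (@measurable_sum _ (salg F2)) => k; exact: measurable_funX.
have mD : measurable (D : set (salg F2)).
  rewrite -[D]setTI; by apply: (@measurable_fun_ler _ (salg F2) R setT _ (cst V) mW2).
pose f (z : salg F1 * salg F2) : \bar R :=
  (expR (\sum_k x z.1 i k 0 * (t * W k z.2)) *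
    (expR (- t) * (\1_D z.2 * Q z.2)))%:E.
have m1 : sigma_of F1 `<=` measurable by exact: feature_gen_measurable.
have m2 : sigma_of F2 `<=` measurable by exact: other_features_gen_measurable.
have mx1 k : measurable_fun [set: salg F1] ((fun w => x w i k 0) : salg F1 -> R).
  by apply: sigma_of_gen; exists k.
have mh : measurable_fun [set: salg F2]
    ((fun w => expR (- t) * (\1_D w * Q w)) : salg F2 -> R).
  by apply: measurable_funM => //; apply: measurable_funM.
have mf : measurable_fun setT f.
  apply/measurable_EFinP; apply: measurable_funM.
    apply: measurableT_comp => //; apply: measurable_sum => k.
    apply: measurable_funM; first exact: (measurableT_comp (mx1 k)).
    apply: measurable_funM => //; exact: (measurableT_comp (mW k)).
  exact: (measurableT_comp mh).
have f0 z : (0 <= f z)%E.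
  by rewrite lee_fin !mulr_ge0 ?expR_ge0// indicE.
have mQT : measurable_fun setT Q by exact: measurable_fun_salg_ambient mQ.
have mWT k : measurable_fun setT (W k) by exact: measurable_fun_salg_ambient (mW k).
have mhT : measurable_fun setT (fun w => expR (- t) * (\1_D w * Q w)).
  by exact: measurable_fun_salg_ambient mh.
have mB : measurable B.
  rewrite (_ : B = D `&` [set w | 1 <= \sum_k x w i k 0 * W k w]); last by [].
  apply: measurableI; first exact: m2.
  rewrite -[X in measurable X]setTI; apply: (measurable_fun_ler (f := cst 1)) => //.
  apply: measurable_sum => k; apply: measurable_funM => //.
  exact: measurable_feature.
(* On the bad event the exponential in [f] is at least 1. *)
apply: (@le_trans _ _ (\int[P]_w f (w, w))%E).
  rewrite integral_indicE; apply: ge0_le_integral => //.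
  - by move=> w _; rewrite -EFinM lee_fin mulr_ge0.
  - apply: emeasurable_funM; first exact/measurable_EFinP.
    by apply/measurable_EFinP; exact: measurable_indic.
  - apply/measurable_EFinP; apply: measurable_funM => //.
    apply: measurableT_comp => //; apply: measurable_sum => k.
    apply: measurable_funM; first exact: measurable_feature.
    by apply: measurable_funM.
  - move=> w _; rewrite -EFinM lee_fin /=.
    rewrite [\1_B w]indicE; case: (boolP (w \in B)) => [|_]; last first.
      by rewrite mulr0 !mulr_ge0 ?expR_ge0// indicE.
    rewrite inE => -[WV xW]; rewrite indicE mem_set// mulr1 mul1r mulrA -expRD.
    rewrite ler_peMl// -expR0 ler_expR.
    rewrite (_ : \sum_k _ = t * \sum_k x w i k 0 * W k w).
      by rewrite subr_ge0 ler_peMr// ltW.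
    by rewrite mulr_sumr; apply: eq_bigr => k _; ring.
have mQE : measurable_fun setT (fun w => (Q w)%:E) by exact/measurable_EFinP.
rewrite -ge0_integralZl_EFin ?expR_ge0//; last by move=> w _; rewrite lee_fin.
apply: (freezing_le m1 m2 (feature_indep HZ (i := i)) mf f0).
  exact: emeasurable_funM.
move=> w; rewrite /f /=; under eq_integral do rewrite EFinM.
have h0 : 0 <= expR (- t) * (\1_D w * Q w).
  by rewrite !mulr_ge0 ?expR_ge0// indicE.
rewrite ge0_integralZr//.
- apply: le_trans (lee_wpmul2r _ (row_mgf (fun k => t * W k w))) _ => //.
  rewrite -!EFinM lee_fin mulrA -expRD indicE.
  case: (boolP (w \in D)) => [|_]; last by rewrite mul0r mulr0 mulr_ge0 ?expR_ge0.
  rewrite inE /D/= => WV; rewrite mul1r ler_wpM2r// ler_expR -/Li.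
  have -> : (2 * v * Li * V)^-1 = t / 2 by rewrite /t; field; rewrite !gt_eqF.
  under eq_bigr do rewrite exprMn.
  rewrite -mulr_sumr.
  have tE : v * Li * V * t = 1 by rewrite /t mulfV// !mulf_neq0 ?gt_eqF.
  have : v * Li * (t ^+ 2 * \sum_k W k w ^+ 2) <= t.
    rewrite -[leRHS]mulr1 -tE [leRHS](_ : _ = v * Li * (t ^+ 2 * V)); last by ring.
    by rewrite ler_wpM2l ?(ltW (mulr_gt0 _ _))// ler_wpM2l// sqr_ge0.
  lra.
- apply/measurable_EFinP; apply: measurableT_comp => //; apply: measurable_sum => k.
  by apply: measurable_funM => //; exact: measurable_feature.
Qed.

End Hoeffding.

(** * The leave-one-out event *)

Section LooEvent.
Context (R : realType) (disp : measure_display) (T : measurableType disp).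
Variable P : probability T R.
Variables (n d : nat) (v : R) (lam : 'rV[R]_d).
Variables (Z : 'I_n -> 'I_d -> {RV P >-> R}) (y : 'I_n -> {RV P >-> R}).
Hypothesis v0 : 0 < v.
Hypothesis lam0 : forall j, 0 < lam 0 j.
Hypothesis HZ : independent_entries v Z.
Hypothesis Hy : label_model (feature lam Z) y.
Hypothesis d0 : (0 < d)%N.

Notation x := (feature lam Z).

(** The other labels are fixed to each of their possible sign patterns in turn: for a
pattern the interpolator is a function of the other features, so
[labels_density] and [hoeffding_frozen] bound the bad event by the probability
of the pattern times the tail. *)
Lemma loo_event_bound (i : 'I_n) (V : R) : 0 < V ->
  exists Bad : set T,
  [/\ measurable Bad,
      (P Bad <= (2 * expR (- (2 * v * linf_norm lam * V)^-1))%:E)%E &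
      forall w, sqnorm (loo_interpolator (x w) i (fun j => y j w)) <= V ->
        1 <= `|((x w i)^T *m loo_interpolator (x w) i (fun j => y j w)) 0 0| ->
        Bad w].
Proof.
move=> V0; set e := expR _.
pose sv (s : {ffun 'I_n -> bool}) j : R := if s j then 1 else -1.
pose A s j := y j @^-1` [set sv s j].
pose E s := \bigcap_(j in [set` [set j | j != i]%SET]) A s j.
pose W s k w := loo_interpolator (x w) i (sv s) k 0.
pose B s (sg : R) := [set w | \sum_k (sg * W s k w) ^+ 2 <= V
  /\ 1 <= \sum_k x w i k 0 * (sg * W s k w)].
have sA s j : sigma_label (fun k => y k) j (A s j).
  rewrite -[A s j]setTI.
  by apply: (sigma_of_gen (F := [set (y j : T -> R)])).
have mA s j : measurable (A s j) by exact: label_measurable (sA s j).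
have mE s : measurable (E s).
  by apply: fin_bigcap_measurable.
have mW s k : measurable_fun [set: salg (other_features_gen lam Z i)]
    (W s k : salg (other_features_gen lam Z i) -> R).
  apply: (@measurable_loo_interpolator _ _ (salg (other_features_gen lam Z i))).
  move=> j l ji; apply: sigma_of_gen; exists j; split => //; by exists l.
have mW' s k : measurable_fun [set: salg (features_gen lam Z)]
    (W s k : salg (features_gen lam Z) -> R).
  by apply: measurable_fun_salgS (mW s k); exact: other_features_genS.
have sB s sg : sigma_of (features_gen lam Z) (B s sg).
  rewrite (_ : B s sg = [set w | \sum_k (sg * W s k w) ^+ 2 <= V] `&`
    [set w | 1 <= \sum_k x w i k 0 * (sg * W s k w)]); last by [].
  apply: (@measurableI _ (salg (features_gen lam Z))).
    rewrite -[X in measurable X]setTI.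
    apply: (@measurable_fun_ler _ (salg (features_gen lam Z)) R setT _ (cst V)) => //.
    apply: measurable_sum => k; apply: measurable_funX.
    by apply: measurable_funM => //; exact: mW'.
  rewrite -[X in measurable X]setTI.
  apply: (@measurable_fun_ler _ (salg (features_gen lam Z)) R setT (cst 1) _) => //.
  apply: measurable_sum => k; apply: measurable_funM.
    by apply: sigma_of_gen; exists i, k.
  by apply: measurable_funM => //; exact: mW'.
have mB s sg : measurable (B s sg) by exact: features_gen_measurable (sB s sg).
have PEB s sg : (P (E s `&` B s sg) <= e%:E * P (E s))%E.
  have [Q [Q0 mQ EQ]] := labels_density HZ Hy i (sA s).
  rewrite -[E s in leRHS]setIT.
  have := EQ (B s sg) (sB s sg); rewrite -/(E s) => ->.
  have sT : sigma_of (features_gen lam Z) setT.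
    exact: (@measurableT _ (salg (features_gen lam Z))).
  have := EQ setT sT; rewrite -/(E s) => ->.
  apply: (hoeffding_frozen v0 lam0 HZ d0 (i := i)
    (W := fun k w => sg * W s k w) V0) => //.
  by move=> k; apply: measurable_funM => //; exact: mW.
pose Bad := \big[setU/set0]_(s : {ffun 'I_n -> bool} | s i)
  (E s `&` (B s 1 `|` B s (- 1))).
have mBad : measurable Bad.
  by apply: bigsetU_measurable => s _; apply: measurableI => //; exact: measurableU.
(* The pattern of the labels, with the convention [true] at [i]. *)
pose pat w : {ffun 'I_n -> bool} := [ffun j => (j == i) || (y j w == 1)].
have Epat (s : {ffun 'I_n -> bool}) w : s i -> E s w -> pat w = s.
  move=> si Ew; apply/ffunP => j; rewrite ffunE.
  have [->|ji] := eqVneq j i; first by rewrite si.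
  have /= := Ew j; rewrite inE ji /A /sv /= => /(_ erefl) ->.
  by case: (s j); [rewrite eqxx|apply/eqP; lra].
exists Bad; split => //.
- apply: le_trans.
    apply: boole_inequality_seq => s _.
    by apply: measurableI => //; exact: measurableU.
  apply: (@le_trans _ _ (\sum_(s : {ffun 'I_n -> bool} | s i) (2 * e)%:E * P (E s))%E).
    apply: lee_sum => s _; rewrite setIUr.
    have mEB sg : measurable (E s `&` B s sg) by exact: measurableI.
    have := measureU2 P (mEB 1) (mEB (- 1)) => /le_trans; apply.
    rewrite mulr_natl mulr2n EFinD ge0_muleDl ?lee_fin ?expR_ge0//.
    by apply: leeD; exact: PEB.
  rewrite -ge0_sume_distrr//.
  rewrite -[leRHS]mule1 lee_wpmul2l ?lee_fin ?mulr_ge0 ?expR_ge0//.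
  (* The events [E s] with [s i] are disjoint, as [s] can be read off from the labels. *)
  pose E' (s : {ffun 'I_n -> bool}) := if s i then E s else set0.
  have mE' s : measurable (E' s) by rewrite /E'; case: ifP.
  rewrite (_ : \sum_(s : {ffun 'I_n -> bool} | s i) P (E s) =
               \sum_s \int[P]_w (\1_(E' s) w)%:E)%E; last first.
    rewrite big_mkcond; apply: eq_bigr => s _; rewrite integral_indic// setIT /E'.
    by case: ifP; rewrite ?measure0.
  rewrite -ge0_integral_sum//; last first.
  + by move=> s; apply/measurable_EFinP; exact: measurable_indic.
  rewrite -[leRHS](probability_setT P) -[leRHS]mul1e -integral_cst//.
  apply: ge0_le_integral => //.
  + by move=> w _; apply: sume_ge0.
  + by apply: emeasurable_sum => s; apply/measurable_EFinP; exact: measurable_indic.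
  + move=> w _; rewrite sumEFin lee_fin (bigD1 (pat w))//= big1 ?addr0.
      by rewrite indicE lern1 leq_b1.
    move=> s sp; rewrite indicE memNset// /E'; case: ifP => si; last by [].
    by move=> /(Epat _ _ si) ps; rewrite ps eqxx in sp.
- move=> w WV W1.
  have y1 j : y j w = -1 \/ y j w = 1 by have [+ _ _] := Hy; exact.
  have svE j : j != i -> sv (pat w) j = y j w.
    move=> ji; rewrite /sv ffunE (negbTE ji)/=.
    by case: (y1 j) => ->; rewrite ?eqxx//; case: eqP => //; lra.
  have Ww : loo_interpolator (x w) i (sv (pat w)) =
            loo_interpolator (x w) i (fun j => y j w).
    exact: eq_loo_interpolator.
  rewrite /Bad -bigcup_seq_cond; exists (pat w).
    by rewrite /= mem_index_enum ffunE eqxx.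
  split; first by move=> j /=; rewrite inE /A/= => /svE ->.
  move: W1; rewrite mxE -Ww; set S := \sum_k _ => W1.
  have sumE sg : \sum_k x w i k 0 * (sg * W (pat w) k w) = sg * S.
    by rewrite mulr_sumr; apply: eq_bigr => k _; rewrite [(x w i)^T _ _]mxE /W; ring.
  have sqE (sg : R) : sg ^+ 2 = 1 -> \sum_k (sg * W (pat w) k w) ^+ 2 <= V.
    move=> sg1; apply: le_trans WV; rewrite -Ww /sqnorm le_eqVlt.
    apply/orP; left; apply/eqP; apply: eq_bigr => k _.
    by rewrite exprMn sg1 mul1r.
  have [S0|S0] := leP 0 S.
    left; split; first by apply: sqE; rewrite expr1n.
    by rewrite sumE mul1r -(ger0_norm S0).
  right; split; first by apply: sqE; rewrite sqrrN expr1n.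
  by rewrite sumE mulN1r -(ltr0_norm S0).
Qed.

End LooEvent.

(** * Proof of the bound *)

(** The lower half of the deviation bound. *)
Lemma coercive_of_quad_dev (R : realType) (disp : measure_display)
    (T : measurableType disp) (P : probability T R) (n d : nat) (lam : 'rV[R]_d)
    (Z : 'I_n -> 'I_d -> {RV P >-> R}) (w : T) :
  (forall j, 0 < lam 0 j) ->
  (forall u : 'I_n -> R, `|quad_dev lam (fun i j => Z i j w) u|
     <= l1_norm lam / 2 * \sum_i u i ^+ 2) ->
  forall u : 'cV[R]_n,
    l1_norm lam / 2 * sqnorm u <= sqnorm (design (feature lam Z w) *m u).
Proof.
move=> lam0 dev u; have := dev (fun i => u i 0).
rewrite -/(sqnorm u); set q := quad_dev _ _ _.
have -> : q = sqnorm (design (feature lam Z w) *m u) - l1_norm lam * sqnorm u.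
  rewrite l1_normE// mulr_suml -sumrB; apply: eq_bigr => k _.
  rewrite mxE mulrBr; congr (_ - _).
  have -> : \sum_j design (feature lam Z w) k j * u j 0 =
      Num.sqrt (lam 0 k) * \sum_i u i 0 * Z i k w.
    by rewrite mulr_sumr; apply: eq_bigr => i _; rewrite mxE featureE; ring.
  by rewrite exprMn sqr_sqrtr// ltW.
rewrite ler_norml => /andP[h _]; lra.
Qed.

Lemma le_complement_bound (R : realType) (disp : measure_display)
    (T : measurableType disp) (P : probability T R) (A : set T) (a b : R) :
  measurable A -> (P (~` A) <= (a + b)%:E)%E -> ((1 - a - b)%:E <= P A)%E.
Proof.
move=> mA; rewrite probability_setC// -(fineK (fin_num_measure P A mA)).
by rewrite -EFinB !lee_fin; lra.
Qed.

Theorem theorem1 (R : realType) :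
  exists C c : R, 0 < C /\ 0 < c /\
  forall (n d : nat) (v : R) (lam : 'rV[R]_d)
    (disp : measure_display) (T : measurableType disp) (P : probability T R)
    (Z : 'I_n -> 'I_d -> {RV P >-> R}) (y : 'I_n -> {RV P >-> R}),
    (1 <= n)%N -> (n <= d)%N -> 0 < v ->
    (forall j, 0 < lam 0 j) ->
    independent_entries v Z ->
    label_model (feature lam Z) y ->
    let sv_event : set T :=
      [set w | all_support_vectors (feature lam Z w) (\row_i y i w)] in
    measurable sv_event /\
    ((1 - expR (- c * Num.min (d_2 lam / v ^+ 2) (d_inf lam / v) + C * n%:R)
        - expR (- c * (d_inf lam / (v * n%:R)) + C * ln n%:R))%:E
      <= P sv_event)%E.
Proof.
have C1_ge1 := centered_sqr_cst_ge1 R.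
have C1_gt0 : 0 < 256 * centered_sqr_cst R by lra.
have c0 : 0 < net_rate R by rewrite invr_gt0.
exists 28, (net_rate R); split => //; split => //.
move=> n d v lam disp T P Z y n1 nd v0 lam0 HZ Hy sv_event.
have d0 : (0 < d)%N by exact: leq_trans nd.
have L0 : 0 < l1_norm lam by exact: l1_norm_gt0.
have Li0 : 0 < linf_norm lam by exact: linf_norm_gt0.
have msv : measurable sv_event.
  apply: measurable_all_support_vectors => [j k|j]; first exact: measurable_feature.
  by under eq_fun do rewrite mxE; exact: measurable_funP.
split => //; apply: le_complement_bound => //.
have [G [mG PG GP]] := gram_concentration v0 lam0 HZ n1 d0.
have yE w j : (\row_i y i w) 0 j = y j w by rewrite mxE.
have y2 w j : y j w ^+ 2 = 1.
  by have [/(_ j w) + _ _] := Hy; case=> ->; rewrite ?sqrrN expr1n.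
have m0 : 0 < l1_norm lam / 2 by rewrite divr_gt0.
pose W w i := loo_interpolator (feature lam Z w) i (fun j => y j w).
have svG w : G w ->
    (forall i, `|((feature lam Z w i)^T *m W w i) 0 0| < 1) -> sv_event w.
  move=> Gw loo; apply: (all_support_vectors_of_loo m0).
  - exact: coercive_of_quad_dev lam0 (GP w Gw).
  - by move=> i; rewrite yE.
  - move=> i; rewrite (eq_loo_interpolator _ (s' := fun j => y j w))//.
(* For a single example the factor [n] cannot be absorbed into [C ln n = 0], but then
  the interpolator is 0 and only the first failure can occur. *)
have [n_eq1|n_gt1] : n = 1%N \/ (1 < n)%N.
  by move: n1; rewrite leq_eqVlt => /orP[/eqP|]; [left|right].
- have GS : ~` sv_event `<=` ~` G.
    apply: subsetC => w Gw; apply: svG => // i.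
    rewrite /W loo_interpolatorE big_pred0 ?mulmx0 ?mxE ?normr0// => j.
    by apply/negbTE; rewrite negbK; apply/eqP/val_inj; move: i j; rewrite n_eq1 => i j;
      rewrite !ord1.
  apply: le_trans (le_measure P _ _ GS) _; rewrite ?inE;
    [exact: measurableC|exact: measurableC|].
  by apply: le_trans PG _; rewrite lee_fin lerDl expR_ge0.
pose V := n%:R / (l1_norm lam / 2).
have nR : 0 < n%:R :> R by rewrite ltr0n.
have V0 : 0 < V by rewrite divr_gt0.
have /choice[Bad Bad_] := fun i => loo_event_bound v0 lam0 HZ Hy d0 i V0.
pose U := \big[setU/set0]_(i < n) Bad i.
have mU : measurable U by apply: bigsetU_measurable => i _; have [] := Bad_ i.
have svU : ~` sv_event `<=` ~` G `|` U.
  move=> w nsv; have [Gw|] := pselect (G w); last by left.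
  right; apply: contrapT => nU; apply: nsv; apply: svG => // i.
  rewrite ltNge; apply/negP => W1; apply: nU.
  rewrite /U -bigcup_seq; exists i; first by rewrite /= mem_index_enum.
  have [_ _] := Bad_ i; apply => //.
  apply: (sqnorm_loo_interpolator m0) => //.
  exact: coercive_of_quad_dev lam0 (GP w Gw).
have mGU : measurable (~` G `|` U) by apply: measurableU => //; exact: measurableC.
apply: le_trans (le_measure P _ _ svU) _; rewrite ?inE//; first exact: measurableC.
apply: le_trans (measureU2 P (measurableC mG) mU) _.
rewrite EFinD; apply: leeD => //.
apply: le_trans.
  by apply: boole_inequality_seq => i _; have [] := Bad_ i.
set e := - (2 * v * linf_norm lam * V)^-1 in Bad_.
apply: (@le_trans _ _ (\sum_(i < n) (2 * expR e)%:E)%E).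
  by apply: lee_sum => i _; have [] := Bad_ i.
rewrite sumEFin lee_fin sumr_const card_ord -[leLHS]mulr_natl.
have eE : e = - (d_inf lam / (v * n%:R)) / 4.
  by rewrite /e /V /d_inf; field; rewrite !gt_eqF.
have D0 : 0 <= d_inf lam / (v * n%:R).
  by rewrite !divr_ge0 ?(ltW L0) ?(ltW Li0)// mulr_ge0// ltW.
have c4 : net_rate R <= 4^-1.
  by rewrite /net_rate lef_pV2 ?posrE//; lra.
have eD : e <= - net_rate R * (d_inf lam / (v * n%:R)).
  rewrite eE mulNr mulNr lerN2 mulrC ler_wpM2l//.
have ee : expR e <= expR (- net_rate R * (d_inf lam / (v * n%:R))).
  by rewrite ler_expR.
(* This needs [n >= 2]. *)
have nn : n%:R * 2 <= expR (28 * ln n%:R) :> R.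
  apply: (@le_trans _ _ (n%:R ^+ 28)).
    apply: (@le_trans _ _ (n%:R ^+ 2)); first by rewrite expr2 ler_wpM2l// ler_nat.
    by rewrite ler_eXn2l// ltr1n.
  by rewrite expRM_natl lnK.
rewrite expRD [leLHS]mulrA [leRHS]mulrC.
by apply: ler_pM => //; exact: mulr_ge0.
Qed.
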